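(* Let $G=(V,E)$ be a graph on $n$ vertices, let $\gamma>0$, $0\le\beta\le\gamma$, $\lambda>0$, and let $\mu_G$ be the Gibbs distribution on $G$ with parameters $\beta,\gamma,\lambda$. Let $\Lambda\subset V$, $\tau\in\{\pm1\}^\Lambda$, let $\mathcal I_G^{\Lambda,\tau}$ be the pairwise influence matrix induced by $\mu_G$, and let $\phi\in\mathbb R^{\mathtt E_{\mathcal S}}$ be the vector of influence weights, indexed by the edges of the walk-trees of the set $\mathcal S$ of self-avoiding walks that do not use vertices of $\Lambda$ (all defined in the context). Let $\mathbf 1\in\mathbb R^{\mathtt E_{{\rm NB}\text{-}n}}_{\ge 0}$ be the all-ones vector. Then for any $\zeta\ge\|\phi\|_\infty$ and $\xi=\zeta\cdot\mathbf 1$, $$\rho\big(\mathcal I_G^{\Lambda,\tau}\big)\ \le\ \rho\big(\mathbf W_{{\rm NB}\text{-}n,\,\xi}\big),$$ where $\mathbf W_{{\rm NB}\text{-}n,\xi}$ is the walk-matrix induced by the set ${\rm NB}\text{-}n$ of all non-backtracking walks in $G$ of length at most $n$ and the weights $\xi$, and $\rho(\cdot)$ denotes the spectral radius.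
   Context: All graphs are finite, undirected, simple and connected. Gibbs distribution: on $\{\pm1\}^V$, $\mu_G(\sigma)\propto\lambda^{\#\{v:\sigma(v)=1\}}\beta^{\#\{\text{edges with both ends }1\}}\gamma^{\#\{\text{edges with both ends }-1\}}$. Influence matrix: indexed by $V\setminus\Lambda$, $\mathcal I_G^{\Lambda,\tau}(w,u)=\mu_u(1\mid(\Lambda,\tau),(\{w\},1))-\mu_u(1\mid(\Lambda,\tau),(\{w\},-1))$, where $\mu_u(1\mid\cdot)$ is the marginal probability that $u$ has spin $1$, conditional on the configuration on $\Lambda$ being $\tau$ and on $w$ having the indicated spin. Walks: a walk of length $\ell$ is a sequence $w_0,\dots,w_\ell$ of vertices with consecutive ones adjacent (a single vertex is a walk of length 0). It is self-avoiding if its vertices are distinct, and non-backtracking if $w_{i-1}\ne w_{i+1}$ for all $1\le i\le\ell-1$. Two walks are adjacent if one extends the other by one vertex at its end. A set $\mathcal P$ of walks is connected if every walk in $\mathcal P$ of length $\ell\ge1$ is adjacent to a walk in $\mathcal P$ of length $\ell-1$; all sets of walks here are finite and connected. The walk-tree $T_{\mathcal P}(r)$ has as vertices the walks of $\mathcal P$ starting at $r$, adjacent when the walks are adjacent; the root is the one-vertex walk $r$. A vertex of $T_{\mathcal P}(r)$ whose walk ends at $u$ is a copy of $u$. $V_{\mathcal P}$ is the set of vertices at which some walk of $\mathcal P$ starts or ends, and $\mathtt E_{\mathcal P}$ is the disjoint union over $r\in V_{\mathcal P}$ of the edge sets of $T_{\mathcal P}(r)$. For $\xi\in\mathbb R^{\mathtt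 E_{\mathcal P}}$ the walk-matrix $\mathbf W_{\mathcal P,\xi}\in\mathbb R^{V_{\mathcal P}\times V_{\mathcal P}}$ has $\mathbf W_{\mathcal P,\xi}(r,u)=\sum_M\prod_{e\in M}\xi(e)$, with $M$ over all paths in $T_{\mathcal P}(r)$ from the root to copies of $u$ (an empty product is 1, an empty sum is 0). Tree of self-avoiding walks and boundary: SAW is the set of walks $w_0,\dots,w_\ell$ that are either self-avoiding, or such that $w_0,\dots,w_{\ell-1}$ is self-avoiding and $w_\ell=w_j$ for some $0\le j\le\ell-3$. Let $T_{\rm SAW}(w)$ be its walk-tree from $w$. Fix a total order on $V$. Boundary condition on $T_{\rm SAW}(w)$: each copy of a vertex $u\in\Lambda$ is fixed to $\tau(u)$; and a vertex corresponding to a walk $w_0,\dots,w_\ell$ with $w_\ell=w_j$ for some $0\le j\le\ell-3$ is fixed to $-1$ if $w_\ell>w_{\ell-1}$, and to $+1$ otherwise. Let $\Gamma$ be the set of vertices with a boundary condition and $\sigma$ the resulting configuration on $\Gamma$. Ratios: for a vertex $z$ of $T_{\rm SAW}(w)$, $R^{\Gamma,\sigma}_z\in[0,+\infty]$ is the ratio of the marginal probability of $+1$ to that of $-1$ at $z$, in the Gibbs distribution with the same parameters $\beta,\gamma,\lambda$ on the subtree consisting of $z$ and its descendants, conditional on the restriction of $\sigma$ to that subtree. Let $h(x)=-\frac{(1-\beta\gamma)e^x}{(\beta e^x+1)(e^x+\gamma)}$ for $x\in[-\infty,+\infty]$ (values at $\pm\infty$ read as limits). Influence weights: $\mathcal S\subseteq{\rm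 SAW}$ is the set of self-avoiding walks in $G$ that use no vertex of $\Lambda$, so that the edges of its walk-trees are also edges of the trees $T_{\rm SAW}(w)$. For an edge $e=\{x,z\}$ with $x$ the parent of $z$, $\phi(e)=0$ if there is a boundary condition at $x$ or at $z$, and $\phi(e)=h(\log R^{\Gamma,\sigma}_z)$ otherwise. $\|\phi\|_\infty=\max_e|\phi(e)|$.
   Formalization: The rule for closing walks is corrected to Weitz's: −1 if w_{j+1} > w_{ℓ−1}, else +1 (with w_ℓ the claim fails on K_{3,3}); for β=0, undefined influence entries are read as 0 and R_z ignores vertices below one with a boundary condition. *)

(* Defs.v *)
From HB Require Import structures.
From mathcomp Require Import all_boot all_order all_algebra.
From mathcomp Require Import all_classical all_reals all_analysis.
From mathcomp Require Import complex.

Set Implicit Arguments.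
Unset Strict Implicit.
Unset Printing Implicit Defensive.

Import Order.TTheory GRing.Theory Num.Theory.
Import numFieldNormedType.Exports.

Local Open Scope ring_scope.

Section LinearAlgebra.
Variable R : realType.

(* The set is finite, so the sup is a max; it is 0 for the empty matrix. *)
Definition spectral_radius (n : nat) (A : 'M[R]_n) : R :=
  sup [set r : R | exists2 z : R[i],
         eigenvalue (map_mx (real_complex R) A) z & r = Normc.normc z]%classic.

(* The matrix with rows and columns indexed by the elements of D. *)
Definition mx_on (T : finType) (D : {set T}) (f : T -> T -> R) : 'M[R]_#|D| :=
  \matrix_(i, j) f (enum_val i) (enum_val j).

End LinearAlgebra.

(* Spins are booleans: true is +1 and false is -1. *)
Section Gibbs.
Variables (R : realType) (T : finType) (e : rel T) (beta gamma lambda : R).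

Local Notation config := {ffun T -> bool}.

Definition edge_set : {set {set T}} :=
  [set [set p.1; p.2] | p in [set p : T * T | e p.1 p.2]]%SET.

Definition weight (s : config) : R :=
  lambda ^+ #|[set v | s v]%SET|
  * beta ^+ #|[set d in edge_set | [forall v in d, s v]]%SET|
  * gamma ^+ #|[set d in edge_set | [forall v in d, ~~ s v]]%SET|.

Definition gibbs (s : config) : R := weight s / \sum_(s' : config) weight s'.

Definition prob (A : {set config}) : R := \sum_(s in A) gibbs s.

Definition cprob (A B : {set config}) : R := prob (A :&: B)%SET / prob B.

Definition spin_at (v : T) (b : bool) : {set config} := [set s : config | s v == b]%SET.

Definition agreeing (D : {set T}) (t : T -> bool) : {set config} :=
  [set s : config | [forall v in D, s v == t v]]%SET.

(* When beta = 0 one of the two conditioning events may have probability zero,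
   so that a conditional marginal is undefined; w is then said to have no
   influence. *)
Definition influence (D : {set T}) (t : T -> bool) (w u : T) : R :=
  let C b := (agreeing D t :&: spin_at w b)%SET in
  if (prob (C true) == 0) || (prob (C false) == 0) then 0
  else cprob (spin_at u true) (C true) - cprob (spin_at u true) (C false).

Definition influence_mx (D : {set T}) (t : T -> bool) : 'M[R]_#|~: D| :=
  mx_on (~: D) (influence D t).

End Gibbs.

Section WalkMatrix.
Variables (R : realType) (V : finType) (e : rel V).

Definition is_walk (p : seq V) : bool := if p is x :: s then path e x s else false.

Definition starts_at (p : seq V) (v : V) : bool :=
  if p is x :: _ then x == v else false.

Definition ends_at (p : seq V) (v : V) : bool :=
  if p is x :: s then last x s == v else false.

(* q extends p by one vertex at its end. *)
Definition extends (p q : seq V) : bool := [exists v, q == rcons p v].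

(* A finite set of walks is a set of sequences of at most N vertices, for some
   N; a walk of length l has l.+1 vertices. *)
Variable N : nat.
Implicit Types (P : {set N.-bseq V}) (r u : V).

Definition walk_vertices P : {set V} :=
  [set v | [exists p in P, starts_at p v || ends_at p v]]%SET.

Definition walk_tree P r : {set N.-bseq V} := [set p in P | starts_at p r]%SET.

(* An edge of a walk-tree is the pair (parent, child) of its ends. *)
Definition tree_edges P r : {set N.-bseq V * N.-bseq V} :=
  [set d | [&& d.1 \in walk_tree P r, d.2 \in walk_tree P r
             & extends d.1 d.2]]%SET.

(* The union is disjoint, since every vertex of [walk_tree P r] starts at r. *)
Definition walk_edges P : {set N.-bseq V * N.-bseq V} :=
  \bigcup_(r in walk_vertices P) tree_edges P r.

(* M lists the vertices of a path of [walk_tree P r] that goes from the root to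
   a copy of u; such a path only moves from parents to children. *)
Definition path_to_copy P r u (M : seq (N.-bseq V)) : bool :=
  if M is p0 :: M' then
    [&& p0 \in walk_tree P r, (p0 : seq V) == [:: r],
        path (fun p q => (p, q) \in tree_edges P r) p0 M'
      & ends_at (last p0 M') u]
  else false.

Definition path_edges (M : seq (N.-bseq V)) : seq (N.-bseq V * N.-bseq V) :=
  zip M (behead M).

(* A path has at most N vertices: the walks along it have lengths 0, 1, 2... *)
Definition walk_mx P (xi : N.-bseq V * N.-bseq V -> R) : 'M[R]_#|walk_vertices P| :=
  mx_on (walk_vertices P) (fun r u =>
    \sum_(M : N.-bseq (N.-bseq V) | path_to_copy P r u M)
      \prod_(d <- path_edges M) xi d).

End WalkMatrix.

Section NonBacktracking.
Variables (V : finType) (e : rel V).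

Fixpoint nonbacktracking (p : seq V) : bool :=
  if p is x :: p' then
    (if p' is _ :: z :: _ then x != z else true) && nonbacktracking p'
  else true.

(* At most k.+1 vertices, that is, length at most k. *)
Definition NB (k : nat) : {set k.+1.-bseq V} :=
  [set p : k.+1.-bseq V | is_walk e p && nonbacktracking p]%SET.

End NonBacktracking.

Section InfluenceWeights.
Variables (R : realType) (disp : Order.disp_t) (V : finOrderType disp).
Variables (e : rel V) (beta gamma lambda : R).
Variables (L : {set V}) (tau : V -> bool).

(* Self-avoiding walks have at most #|V| vertices, and the walks of [SAW] at
   most one more. *)
Local Notation walk := (#|V|.+1.-bseq V).

(* w_0, ..., w_l with w_0, ..., w_(l-1) self-avoiding and w_l = w_j for some
   j <= l - 3; here l = size s and w_0, ..., w_(l-1) is [belast x s]. *)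
Definition closing (p : seq V) : bool :=
  if p is x :: s then
    uniq (belast x s) && (index (last x s) (belast x s) + 3 <= size s)%N
  else false.

Definition SAW : {set walk} :=
  [set p : walk | is_walk e p && (uniq p || closing p)]%SET.

(* The boundary condition of a vertex of the tree of self-avoiding walks, if any.
   At a closing walk this is Weitz's rule: the spin is -1 when w_(j+1) > w_(l-1)
   and +1 otherwise, so that the two directions of traversing a cycle through
   w_j get opposite spins. The rule with w_l in place of w_(j+1) does not have
   this property, and with it the spectral radius of the influence matrix is no
   longer bounded by that of the walk-matrix: on K_(3,3) with one side above the
   other, no pinned vertex, beta = gamma = 1/100 and lambda = 1, the former is
   about 6 and the latter at most 4/3. *)
Definition boundary (p : seq V) : option bool :=
  if p is x :: s then
    let v := last x s in
    if v \in L then Some (tau v)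
    else if closing p then
      let j := index v (belast x s) in
      Some (~~ (nth x p (size s).-1 < nth x p j.+1)%O)
    else None
  else None.

(* The descendants of z (z included) that are not below another descendant with
   a boundary condition. Given the boundary condition, the spin at z does not
   depend on the rest; keeping the rest could however give the boundary condition
   probability zero when beta = 0, for instance by a closing walk of spin +1
   below a copy of a vertex of L of spin +1. *)
Definition subtree (z : walk) : {set walk} :=
  [set p in SAW | prefix z p &
     [forall q in SAW, [&& prefix z q, prefix q p & q != p] ==> (boundary q == None)]]%SET.

Definition subtree_vertex (z : walk) : finType := {p : walk | p \in subtree z}.

Definition subtree_rel (z : walk) : rel (subtree_vertex z) :=
  fun p q => extends (val p) (val q) || extends (val q) (val p).

Definition subtree_boundary (z : walk) : {set {ffun subtree_vertex z -> bool}} :=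
  [set s : {ffun subtree_vertex z -> bool} |
     [forall p : subtree_vertex z, if boundary (val p) is Some b then s p == b else true]]%SET.

Definition subtree_root_spin (z : walk) (b : bool) :
    {set {ffun subtree_vertex z -> bool}} :=
  [set s : {ffun subtree_vertex z -> bool} |
     [forall p : subtree_vertex z, (val p == z) ==> (s p == b)]]%SET.

Definition ratio (z : walk) : \bar R :=
  let m b := cprob (@subtree_rel z) beta gamma lambda
               (subtree_root_spin z b) (subtree_boundary z) in
  if m false == 0 then +oo%E else (m true / m false)%:E.

Definition h_fin (x : R) : R :=
  - ((1 - beta * gamma) * expR x / ((beta * expR x + 1) * (expR x + gamma))).

Definition h (x : \bar R) : R :=
  match x with
  | r%:E => h_fin r
  | +oo%E => lim (h_fin r @[r --> +oo])%classic
  | -oo%E => lim (h_fin r @[r --> -oo])%classic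
  end.

Definition phi (d : walk * walk) : R :=
  if (boundary d.1 != None) || (boundary d.2 != None) then 0
  else h (lne (ratio d.2)).

Definition SAW_avoiding : {set walk} :=
  [set p : walk | [&& is_walk e p, uniq p & all (fun v => v \notin L) p]]%SET.

Definition phi_norm : R := \big[Num.max/0]_(d in walk_edges SAW_avoiding) `|phi d|.

End InfluenceWeights.

(* Main.v *)
Require Import Defs.
From mathcomp Require Import all_boot all_order all_algebra.
From mathcomp Require Import all_reals exp.
From mathcomp Require Import complex polyrcf.
From mathcomp Require Import ring lra zify.
Import Order.TTheory GRing.Theory Num.Theory.
Local Open Scope ring_scope.

Set Implicit Arguments.
Unset Strict Implicit.
Unset Printing Implicit Defensive.

(** Each nonzero entry of the influence matrix is a sum over self-avoiding walks of
    products of influence weights. It is thus at most the sum of zeta^l over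
    these walks, l being the length, and so at most the corresponding entry of
    the walk-matrix, since self-avoiding walks are non-backtracking and have
    length less than n. The spectral radius is monotone for such a domination
    ([spectral_radius_le]), by the part of Perron-Frobenius theory that says that
    a subinvariant nonnegative vector forces a large real eigenvalue ([perron]).

    The expansion of the influence comes from one computation. All conditional
    Gibbs measures are written as partition functions [partition_fun] on the set
    of vertices that are not pinned yet, with weights on these vertices. Pinning
    w, and deleting it, only rescales the weights of its neighbours
    ([partition_fun_peel]). To compare the pinnings of w to -1 and to +1, change
    the weights of the neighbours v of w one at a time. If r is the ratio of the
    probabilities of +1 and -1 at v at that time, leaving out the edge from w to v,
    then changing v multiplies the partition function by (beta r + 1) / (r + gamma)
    and adds h(log r) times the influence of v on u to the probability of +1 at u.
    This yields Weitz's recursion for ratios ([spin_ratio_rec]) and the recursion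
    for influences ([plus_influence_rec]).

    Along a self-avoiding walk, these recursions remember for each visited vertex
    which of its neighbours had already been changed. This is a pinned copy of
    the visited vertex, whose spin depends on the order of the neighbours
    ([walk_field]), and it is what the boundary condition on closing walks
    encodes on the tree ([tree_field_walk]). Since the tree is a graph too, its
    ratios obey the same recursion; there, the children of a vertex lie in
    different components once the vertex is removed. Hence the ratios of the
    graph met along a walk are those of the tree ([tree_ratio_walk]), and the
    factors h(log r) are the influence weights. *)

(** * Partition functions with arbitrary vertex weights *)

Section PartitionFunction.
Variables (R : realFieldType) (T : finType) (e : rel T).
Hypotheses (e_sym : symmetric e) (e_irr : irreflexive e).
Variables beta gamma : R.
Implicit Types (U S X : {set T}) (F : T -> bool -> R) (u v w x : T) (b c : bool).

Definition inner_edges S : {set {set T}} := [set d in edge_set e | d \subset S].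

Definition coupling b : R := if b then beta else gamma.

(** A pinned vertex acts on the others only through the weights of its neighbours.
    With weights F that vary with the vertex, conditional Gibbs measures therefore
    stay within this family, on the set U of the vertices that are left. *)
Definition partition_fun U F : R :=
  \sum_(S : {set T} | S \subset U)
    (\prod_(x in U) F x (x \in S))
    * beta ^+ #|inner_edges S| * gamma ^+ #|inner_edges (U :\: S)|.

(** What the vertices of X gain when a common neighbour is pinned to b. *)
Definition boost (X : pred T) b F x c : R :=
  F x c * (if X x && (c == b) then coupling b else 1).

Lemma partition_fun_eq U F F' :
  (forall x, x \in U -> F x =1 F' x) -> partition_fun U F = partition_fun U F'.
Proof.
move=> eqF; apply: eq_bigr => S _; congr (_ * _ * _).
by apply: eq_bigr => x xU; apply: eqF.
Qed.

Lemma partition_fun0 F : partition_fun set0 F = 1.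
Proof.
have ie0: inner_edges set0 = set0.
  apply/setP => d; rewrite !inE subset0; apply/negbTE/andP => -[/imsetP[p _ ->]].
  by move=> /eqP/setP/(_ p.1); rewrite !inE eqxx.
rewrite /partition_fun (big_pred1 set0) => [|S]; last by rewrite subset0.
by rewrite set0D big_set0 ie0 cards0 !mulr1.
Qed.

Lemma edge_in w x : ([set w; x] \in edge_set e) = e w x.
Proof.
apply/imsetP/idP => [[[a b]]|ewx]; last by exists (w, x); rewrite ?inE.
rewrite inE /= => eab /setP E.
have := E w; have := E x; have := E a; have := E b; rewrite !inE !eqxx ?orbT.
have abF: a != b by apply/eqP => ab; rewrite ab e_irr in eab.
move=> /orP[]/eqP bE /orP[]/eqP aE; subst.
- by rewrite eqxx in abF.
- by rewrite e_sym.
- by [].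
- by rewrite eqxx in abF.
Qed.

Lemma card_inner_edgesU1 w S : w \notin S ->
  #|inner_edges (w |: S)| = (#|inner_edges S| + #|[set x in S | e w x]|)%N.
Proof.
move=> wS; set N := [set x in S | e w x].
have injN: {in N &, injective (fun x => [set w; x])}.
  move=> x y; rewrite !inE => /andP[xS _] /andP[yS _] /setP/(_ x).
  rewrite !inE eqxx orbT => /esym/orP[]/eqP // xw.
  by rewrite -xw xS in wS.
rewrite -(card_in_imset injN) -[RHS]cardsUI.
have ->: inner_edges S :&: [set [set w; x] | x in N] = set0.
  apply/setP => d; rewrite !inE; apply/negbTE/andP => -[/andP[_ dS]].
  case/imsetP => x _ dE; move/subsetP: dS => /(_ w).
  by rewrite dE !inE eqxx (negPf wS) => /(_ isT).
rewrite cards0 addn0; congr #|pred_of_set _|; apply/setP => d; rewrite !inE.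
apply/andP/orP => [[dE dS]|[/andP[dE dS]|/imsetP[x]]].
- case wd: (w \in d); last first.
    left; rewrite dE; apply/subsetP => x xd.
    have := subsetP dS x xd; rewrite !inE => /orP[/eqP xw|//].
    by rewrite -xw xd in wd.
  right; case/imsetP: (dE) => -[a b]; rewrite inE /= => eab dab.
  have abF: a != b by apply/eqP => ab; rewrite ab e_irr in eab.
  have ad: a \in d by rewrite dab !inE eqxx.
  have bd: b \in d by rewrite dab !inE eqxx orbT.
  have aS := subsetP dS a ad; have bS := subsetP dS b bd.
  move: wd aS bS; rewrite dab !inE => /orP[]/eqP wE; subst.
  + rewrite [b == a]eq_sym (negPf abF) /= => _ bS.
    by apply/imsetP; exists b; rewrite ?inE ?bS ?eab.
  + rewrite (negPf abF) /= => aS _.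
    by apply/imsetP; exists a; rewrite ?inE ?aS 1?e_sym ?eab 1?setUC.
- by rewrite dE (subset_trans dS) // subsetUr.
- rewrite !inE => /andP[xS ewx] ->; rewrite edge_in ewx; split=> //.
  by apply/subsetP => y; rewrite !inE => /orP[]/eqP ->; rewrite ?eqxx ?xS ?orbT.
Qed.

Lemma expr_card_nbr (a : R) w S :
  a ^+ #|[set x in S | e w x]| = \prod_(x in S) (if e w x then a else 1).
Proof.
rewrite -prodr_const -big_mkcondr /=.
by apply: eq_bigl => x; rewrite inE.
Qed.

(** Deciding the spin of w first: the edges at w only rescale the weights of
    its neighbours. *)
Lemma partition_fun_peel U F w : w \in U ->
  partition_fun U F = F w true * partition_fun (U :\ w) (boost (e w) true F)
                    + F w false * partition_fun (U :\ w) (boost (e w) false F).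
Proof.
move=> wU; rewrite /partition_fun (bigID (fun S => w \in S)) /= !mulr_sumr.
congr (_ + _).
- rewrite (reindex_onto (fun S => w |: S) (fun S => S :\ w)) /=; last first.
    by move=> S /andP[_ wS]; rewrite setD1K.
  apply: eq_big => [S|S /andP[/andP[SU _] /eqP SE]].
    rewrite setU11 andbT subUset sub1set wU /= subsetD1; congr (_ && _).
    apply/eqP/idP => [<-|wS]; first by rewrite !inE eqxx.
    by rewrite setU1K.
  have wS: w \notin S by rewrite -SE !inE eqxx.
  rewrite (big_setD1 w) //= setU11 card_inner_edgesU1 // exprD.
  have -> : U :\: (w |: S) = (U :\ w) :\: S by rewrite setDDl.
  rewrite !mulrA; congr (_ * _); rewrite -!mulrA; congr (_ * _).
  rewrite [_ ^+ _ * _ ^+ _]mulrC !mulrA; congr (_ * _).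
  have SU': S \subset U :\ w by rewrite -SE setSD.
  rewrite expr_card_nbr.
  have -> : \prod_(x in S) (if e w x then beta else 1)
          = \prod_(x in U :\ w) (if e w x && ((x \in S) == true) then beta else 1).
    rewrite [RHS](big_setID S) /= (setIidPr SU') [X in _ = _ * X]big1 ?mulr1 => [|x].
      by apply: eq_bigr => x ->; rewrite andbT.
    by rewrite inE => /andP[/negPf-> _]; rewrite andbF.
  rewrite -big_split /=; apply: eq_bigr => x; rewrite !inE => /andP[/negPf-> _] /=.
  by rewrite /boost.
- apply: eq_big => [S|S /andP[SU wS]].
    by rewrite subsetD1.
  rewrite (big_setD1 w) //= (negPf wS).
  have -> : U :\: S = w |: ((U :\ w) :\: S).
    apply/setP => x; rewrite !inE; case: eqVneq => [->|] //=.
    by rewrite (negPf wS) wU.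
  rewrite card_inner_edgesU1 ?inE ?eqxx ?andbF // exprD.
  rewrite -!mulrA; congr (_ * _).
  rewrite [gamma ^+ _ * _]mulrC !mulrA; congr (_ * _).
  rewrite mulrAC; congr (_ * _).
  rewrite expr_card_nbr.
  have -> : \prod_(x in (U :\ w) :\: S) (if e w x then gamma else 1)
          = \prod_(x in U :\ w) (if e w x && ((x \in S) == false) then gamma else 1).
    rewrite [RHS](big_setID S) /= [X in _ = X * _]big1 ?mul1r => [|x].
      by apply: eq_bigr => x; rewrite inE => /andP[/negPf-> _]; rewrite andbT.
    by rewrite inE => /andP[_ ->]; rewrite andbF.
  by rewrite -big_split /=; apply: eq_bigr => x _; rewrite /boost.
Qed.

End PartitionFunction.

(** * Ratios and influences: telescoping over the neighbours of a vertex *)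

Section Telescoping.
Variables (R : realFieldType) (T : finType) (e : rel T).
Hypotheses (e_sym : symmetric e) (e_irr : irreflexive e).
Variables beta gamma : R.
Hypotheses (gamma_gt0 : 0 < gamma) (beta_ge0 : 0 <= beta).
Implicit Types (U W : {set T}) (F : T -> bool -> R) (u v w x : T) (b c : bool).

Local Notation Z := (partition_fun e beta gamma).
Local Notation boost := (boost beta gamma).

Definition pin u b F x c : R := if (x == u) && (c != b) then 0 else F x c.

(** The terms of the partition function where w has spin b. *)
Definition spin_weight U F w b : R := F w b * Z (U :\ w) (boost (e w) b F).

Definition spin_ratio U F w : R := spin_weight U F w true / spin_weight U F w false.

Definition plus_prob U F u : R := Z U (pin u true F) / Z U F.

(** Conditioning on the spin of w is removing w and boosting its neighbours. Unlike
    the conditional probabilities, the two boosted measures exist even if the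
    spin +1 has weight 0 at w. *)
Definition plus_influence U F w u : R :=
  if u == w then 1
  else plus_prob (U :\ w) (boost (e w) true F) u
       - plus_prob (U :\ w) (boost (e w) false F) u.

(** With a positive weight for -1 at each vertex, the configuration of spins -1
    makes all partition functions positive. The weight of +1 can vanish: for
    beta = 0, a vertex next to a vertex pinned to +1 is forced to -1. *)
Definition admissible U F : Prop := forall x, x \in U -> 0 < F x false /\ 0 <= F x true.

Lemma admissible_sub U W F : W \subset U -> admissible U F -> admissible W F.
Proof. by move=> /subsetP sWU aF x /sWU/aF. Qed.

Lemma admissible_boost U X b F : admissible U F -> admissible U (boost X b F).
Proof.
move=> aF x /aF[F0 F1]; rewrite /boost; split.
  by apply: mulr_gt0 => //; case: ifP => // /andP[_ /eqP<-].
by apply: mulr_ge0 => //; case: ifP => // /andP[_ /eqP<-].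
Qed.

Lemma partition_fun_gt0 U F : admissible U F -> 0 < Z U F.
Proof.
have [n] := ubnP #|U|; elim: n U F => // n IHn U F leUn aF.
have [->|[w wU]] := set_0Vmem U; first by rewrite partition_fun0.
have [F0 F1] := aF w wU.
have aU b : admissible (U :\ w) (boost (e w) b F).
  exact/admissible_boost/(admissible_sub (subsetDl _ _) aF).
have ltU : (#|U :\ w| < n)%N by move: leUn; rewrite (cardsD1 w) wU.
rewrite (partition_fun_peel _ _ _ _ _ wU) // ltr_wpDl //.
  by rewrite mulr_ge0 // ltW // IHn.
by rewrite mulr_gt0 // IHn.
Qed.

Lemma spin_weight_gt0 U F w : w \in U -> admissible U F ->
  0 < spin_weight U F w false /\ 0 <= spin_weight U F w true.
Proof.
move=> wU aF; have [F0 F1] := aF w wU.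
have Zgt b : 0 < Z (U :\ w) (boost (e w) b F).
  exact/partition_fun_gt0/admissible_boost/(admissible_sub (subsetDl _ _) aF).
by split; [apply: mulr_gt0 | apply: mulr_ge0 => //; apply: ltW].
Qed.

Lemma spin_ratio_ge0 U F w : w \in U -> admissible U F -> 0 <= spin_ratio U F w.
Proof. by move=> wU aF; have [? ?] := spin_weight_gt0 wU aF; rewrite divr_ge0 // ltW. Qed.

Lemma boost_eq U X b F F' : (forall x, x \in U -> F x =1 F' x) ->
  forall x, x \in U -> boost X b F x =1 boost X b F' x.
Proof. by move=> eqF x xU c; rewrite /boost eqF. Qed.

Lemma spin_weight_eq U F F' w b : w \in U -> (forall x, x \in U -> F x =1 F' x) ->
  spin_weight U F w b = spin_weight U F' w b.
Proof.
move=> wU eqF; rewrite /spin_weight eqF //; congr (_ * _).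
by apply: partition_fun_eq; apply: boost_eq => x /setD1P[_] /eqF.
Qed.

Lemma spin_ratio_eq U F F' w : w \in U -> (forall x, x \in U -> F x =1 F' x) ->
  spin_ratio U F w = spin_ratio U F' w.
Proof. by move=> wU eqF; rewrite /spin_ratio !(spin_weight_eq _ wU eqF). Qed.

Lemma plus_prob_eq U F F' u : (forall x, x \in U -> F x =1 F' x) ->
  plus_prob U F u = plus_prob U F' u.
Proof.
move=> eqF; congr (_ / _); apply: partition_fun_eq => // x xU c.
by rewrite /pin eqF.
Qed.

Lemma plus_influence_eq U F F' w u : (forall x, x \in U -> F x =1 F' x) ->
  plus_influence U F w u = plus_influence U F' w u.
Proof.
move=> eqF; rewrite /plus_influence; case: ifP => // _.
by congr (_ - _); apply: plus_prob_eq; apply: boost_eq => x /setD1P[_] /eqF.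
Qed.

Lemma partition_fun_peel_off U F F' v : v \in U ->
    (forall x, x \in U :\ v -> F' x =1 F x) ->
  Z U F' = F' v true * Z (U :\ v) (boost (e v) true F)
         + F' v false * Z (U :\ v) (boost (e v) false F).
Proof.
move=> vU eqF; rewrite (partition_fun_peel _ _ _ _ _ vU) //.
by congr (_ * _ + _ * _); apply: partition_fun_eq; apply: boost_eq.
Qed.

Lemma partition_fun_boost1 W F v b : v \in W ->
  Z W (boost (pred1 v) b F)
  = coupling beta gamma b * spin_weight W F v b + spin_weight W F v (~~ b).
Proof.
move=> vW; rewrite (partition_fun_peel_off vW (F := F)); last first.
  by move=> x /setD1P[/negPf xv _] c; rewrite /boost /= xv mulr1.
rewrite /spin_weight /boost /= eqxx; case: b => /=; rewrite ?mulr1.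
  by rewrite -mulrA mulrCA.
by rewrite addrC -[F v false * _ * _]mulrA mulrCA.
Qed.

(** The quotient of the partition functions for the two boosts of a vertex, in
    terms of its ratio r before boosting. *)
Definition ratio_step (r : R) : R := (beta * r + 1) / (r + gamma).

(** The function h of the influence weights, in terms of r = exp x. *)
Definition influence_step (r : R) : R :=
  - ((1 - beta * gamma) * r / ((beta * r + 1) * (r + gamma))).

Lemma boost1_ratio W F v : v \in W -> admissible W F ->
  Z W (boost (pred1 v) true F) / Z W (boost (pred1 v) false F)
  = ratio_step (spin_ratio W F v).
Proof.
move=> vW aF; have [w0 w1] := spin_weight_gt0 vW aF.
rewrite !partition_fun_boost1 // /ratio_step /spin_ratio /=.
move: w0 w1; set a := spin_weight W F v false; set b := spin_weight W F v true.
move=> a0 b0.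
have ? : 0 < gamma * a + b by apply: ltr_pwDl => //; apply: mulr_gt0.
by field; rewrite ?lt0r_neq0 // addrC // mulrC.
Qed.

(** The two boosts of v mix the measures conditioned on the spin of v in
    different proportions; the factor is the difference of these proportions. *)
Lemma boost1_influence W F v u : v \in W -> admissible W F ->
  plus_prob W (boost (pred1 v) true F) u - plus_prob W (boost (pred1 v) false F) u
  = influence_step (spin_ratio W F v) * plus_influence W F v u.
Proof.
move=> vW aF; have [F0 F1] := aF v vW.
rewrite /plus_influence /plus_prob !partition_fun_boost1 //=.
have pinE b : Z W (pin u true (boost (pred1 v) b F))
    = pin u true (boost (pred1 v) b F) v true * Z (W :\ v) (boost (e v) true (pin u true F))
    + pin u true (boost (pred1 v) b F) v false * Z (W :\ v) (boost (e v) false (pin u true F)).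
  apply: partition_fun_peel_off => // x /setD1P[/negPf xv _] c.
  by rewrite /pin /boost /= xv mulr1.
have Zgt b : 0 < Z (W :\ v) (boost (e v) b F).
  exact/partition_fun_gt0/admissible_boost/(admissible_sub (subsetDl _ _) aF).
have boost_pin b : Z (W :\ v) (boost (e v) b (pin u true F))
                 = Z (W :\ v) (pin u true (boost (e v) b F)).
  by apply: partition_fun_eq => x _ c; rewrite /pin /boost; case: ifP; rewrite ?mul0r.
rewrite !pinE !boost_pin /influence_step /spin_ratio /spin_weight.
move: (Zgt true) (Zgt false).
set z1 := Z _ (boost _ true F); set z0 := Z _ (boost _ false F) => z1gt z0gt.
have d1 : 0 < beta * (F v true * z1) + F v false * z0.
  by apply: ltr_wpDl; rewrite ?mulr_ge0 ?mulr_gt0 ?(ltW z1gt).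
have d2 : 0 < F v true * z1 + gamma * (F v false * z0).
  by apply: ltr_wpDl; rewrite ?mulr_ge0 ?mulr_gt0 ?(ltW z1gt).
have [->|uv] := eqVneq u v.
  rewrite /pin /boost /= !eqxx /= {pinE boost_pin}.
  have -> : Z (W :\ v) (pin v true (boost (e v) true F)) = z1.
    by apply: partition_fun_eq => x /setD1P[/negPf xv _] c; rewrite /pin xv.
  by field; rewrite !lt0r_neq0.
rewrite /pin /boost /= eq_sym (negPf uv) /= !eqxx /= {pinE boost_pin}.
by field; rewrite !lt0r_neq0.
Qed.

Variable r : rel T.
Hypothesis r_asym : forall x y, r x y -> ~~ r y x.

(** The weights when the boost of X is being switched from -1 to +1 one vertex at a
    time, in decreasing order, and the turn of v has come. *)
Definition hybrid (X : pred T) v F :=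
  boost [pred x | X x && r v x] true (boost [pred x | X x && r x v] false F).

Lemma admissible_hybrid U X v F : admissible U F -> admissible U (hybrid X v F).
Proof. by move=> aF; do 2![apply: admissible_boost]. Qed.

(** The head of a sorted list is switched last, once its tail is entirely boosted
    by +1; until then it remains boosted by -1. *)
Lemma hybrid_cons v l F : pairwise r (v :: l) ->
  hybrid (mem (v :: l)) v F =2 boost (mem l) true F /\
  {in l, forall v', hybrid (mem (v :: l)) v' F =2 hybrid (mem l) v' (boost (pred1 v) false F)}.
Proof.
have r_irr x : r x x = false by apply/negbTE/negP => rxx; have := r_asym rxx; rewrite rxx.
move=> /= /andP[/allP rv _]; split=> [x c|v' v'l x c]; rewrite /hybrid /boost /= !inE.
  have -> : ((x == v) || (x \in l)) && r v x = (x \in l).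
    case: eqVneq => [->|_] /=; last by apply/andb_idr/rv.
    by rewrite r_irr; apply/esym/negbTE/negP => /rv; rewrite r_irr.
  have -> : ((x == v) || (x \in l)) && r x v = false.
    case: eqVneq => [->|_] /=; first exact: r_irr.
    by apply/negbTE/negP => /andP[/rv/r_asym/negPf->].
  by rewrite mulr1.
have [->|] := eqVneq x v; last by rewrite mulr1.
rewrite rv // (negPf (r_asym (rv _ v'l))) !andbF /=.
have -> : (v \in l) = false by apply/negbTE/negP => /rv; rewrite r_irr.
by rewrite /= !mulr1.
Qed.

Lemma pairwise_notin v l : pairwise r (v :: l) -> v \notin l.
Proof.
move=> /= /andP[/allP rv _]; apply/negP => /rv rvv.
by have := r_asym rvv; rewrite rvv.
Qed.

Lemma boost_cons b v l F : v \notin l ->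
  boost (mem (v :: l)) b F =2 boost (pred1 v) b (boost (mem l) b F).
Proof.
move=> vl x c; rewrite /boost /= inE; have [->|] := eqVneq x v => /=.
  by rewrite (negPf vl) /= mulr1.
by rewrite mulr1.
Qed.

(** Switching the boosts of l one by one telescopes. *)
Lemma boost_ratio W F l : pairwise r l -> {subset l <= W} -> admissible W F ->
  Z W (boost (mem l) true F) / Z W (boost (mem l) false F)
  = \prod_(v <- l) ratio_step (spin_ratio W (hybrid (mem l) v F) v).
Proof.
elim: l F => [|v l IHl] F pl lW aF.
  rewrite big_nil (@partition_fun_eq _ _ _ _ _ W _ (boost (mem [::]) false F)) ?divff //.
  exact/lt0r_neq0/partition_fun_gt0/admissible_boost.
have vW : v \in W by apply: lW; rewrite inE eqxx.
have [hv hl] := hybrid_cons F pl; have vl := pairwise_notin pl.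
rewrite big_cons (spin_ratio_eq vW (F' := boost (mem l) true F)); last by move=> x _; apply: hv.
rewrite -boost1_ratio //; last exact: admissible_boost.
have pl' : pairwise r l by case/andP: pl.
under eq_big_seq => v' v'l.
  rewrite (spin_ratio_eq _ (F' := hybrid (mem l) v' (boost (pred1 v) false F))); first over.
    by apply: lW; rewrite inE v'l orbT.
  by move=> x _; apply: hl.
rewrite -IHl //; last 2 first.
- by move=> x xl; apply: lW; rewrite inE xl orbT.
- exact: admissible_boost.
have E1 : Z W (boost (mem (v :: l)) true F) = Z W (boost (pred1 v) true (boost (mem l) true F)).
  by apply: partition_fun_eq => x _; apply: boost_cons.
have E0 : Z W (boost (mem (v :: l)) false F) = Z W (boost (mem l) false (boost (pred1 v) false F)).
  by apply: partition_fun_eq => x _ c; rewrite boost_cons // /boost mulrAC.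
have E10 : Z W (boost (pred1 v) false (boost (mem l) true F))
         = Z W (boost (mem l) true (boost (pred1 v) false F)).
  by apply: partition_fun_eq => x _ c; rewrite /boost mulrAC.
rewrite E1 E0 E10 mulrA divfK //.
by apply/lt0r_neq0/partition_fun_gt0; do 2![apply: admissible_boost].
Qed.

(** The same telescoping, for a difference in place of a quotient. *)
Lemma boost_influence W F l u : pairwise r l -> {subset l <= W} -> admissible W F ->
  plus_prob W (boost (mem l) true F) u - plus_prob W (boost (mem l) false F) u
  = \sum_(v <- l) influence_step (spin_ratio W (hybrid (mem l) v F) v)
                  * plus_influence W (hybrid (mem l) v F) v u.
Proof.
elim: l F => [|v l IHl] F pl lW aF.
  by rewrite big_nil (@plus_prob_eq W _ (boost (mem [::]) false F)) ?subrr.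
have vW : v \in W by apply: lW; rewrite inE eqxx.
have [hv hl] := hybrid_cons F pl; have vl := pairwise_notin pl.
rewrite big_cons (spin_ratio_eq vW (F' := boost (mem l) true F)); last by move=> x _; apply: hv.
rewrite (@plus_influence_eq W _ (boost (mem l) true F)); last by move=> x _; apply: hv.
rewrite -boost1_influence //; last exact: admissible_boost.
have pl' : pairwise r l by case/andP: pl.
under eq_big_seq => v' v'l.
  rewrite (spin_ratio_eq _ (F' := hybrid (mem l) v' (boost (pred1 v) false F))); last 2 first.
  - by apply: lW; rewrite inE v'l orbT.
  - by move=> x _; apply: hl.
  rewrite (@plus_influence_eq W _ (hybrid (mem l) v' (boost (pred1 v) false F))); first over.
  by move=> x _; apply: hl.
rewrite -IHl //; last 2 first.
- by move=> x xl; apply: lW; rewrite inE xl orbT.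
- exact: admissible_boost.
have E1 : plus_prob W (boost (mem (v :: l)) true F) u
        = plus_prob W (boost (pred1 v) true (boost (mem l) true F)) u.
  by apply: plus_prob_eq => x _; apply: boost_cons.
have E0 : plus_prob W (boost (mem (v :: l)) false F) u
        = plus_prob W (boost (mem l) false (boost (pred1 v) false F)) u.
  by apply: plus_prob_eq => x _ c; rewrite boost_cons // /boost mulrAC.
have E10 : plus_prob W (boost (pred1 v) false (boost (mem l) true F)) u
         = plus_prob W (boost (mem l) true (boost (pred1 v) false F)) u.
  by apply: plus_prob_eq => x _ c; rewrite /boost mulrAC.
by rewrite E1 E0 E10 addrA subrK.
Qed.

Lemma boost_restrict W (X : pred T) (l : seq T) b F : (forall x, x \in W -> X x = (x \in l)) ->
  forall x, x \in W -> boost X b F x =1 boost (mem l) b F x.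
Proof. by move=> XE x xW c; rewrite /boost /= XE. Qed.

Lemma hybrid_restrict W (X : pred T) (l : seq T) v F : (forall x, x \in W -> X x = (x \in l)) ->
  forall x, x \in W -> hybrid X v F x =1 hybrid (mem l) v F x.
Proof. by move=> XE x xW c; rewrite /hybrid /boost /= XE. Qed.

(** Weitz's recursion: w splits into one copy for each of its neighbours, and
    the copies change from -1 to +1 one at a time. *)
Lemma spin_ratio_rec U F w l : w \in U -> admissible U F -> pairwise r l ->
    (forall v, (v \in l) = (v \in U :\ w) && e w v) ->
  spin_ratio U F w = F w true / F w false
    * \prod_(v <- l) ratio_step (spin_ratio (U :\ w) (hybrid (e w) v F) v).
Proof.
move=> wU aF pl lE; rewrite /spin_ratio /spin_weight -mulf_div; congr (_ * _).
have eE x : x \in U :\ w -> e w x = (x \in l) by rewrite lE => ->.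
have lW : {subset l <= U :\ w} by move=> x; rewrite lE => /andP[].
have aW := admissible_sub (subsetDl _ [set w]) aF.
rewrite !(partition_fun_eq _ _ _ (boost_restrict _ _ eE)) boost_ratio //.
apply: eq_big_seq => v vl; congr ratio_step; apply/esym/spin_ratio_eq; first exact: lW.
exact: hybrid_restrict.
Qed.

(** Following the same changes, the influence of w is passed on by its neighbours.
    Iterated, this is a sum over the self-avoiding walks from w to u. *)
Lemma plus_influence_rec U F w u l : w \in U -> admissible U F -> pairwise r l ->
    (forall v, (v \in l) = (v \in U :\ w) && e w v) -> u != w ->
  plus_influence U F w u =
    \sum_(v <- l) influence_step (spin_ratio (U :\ w) (hybrid (e w) v F) v)
                  * plus_influence (U :\ w) (hybrid (e w) v F) v u.
Proof.
move=> wU aF pl lE uw; rewrite {1}/plus_influence (negPf uw).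
have eE x : x \in U :\ w -> e w x = (x \in l) by rewrite lE => ->.
have lW : {subset l <= U :\ w} by move=> x; rewrite lE => /andP[].
have aW := admissible_sub (subsetDl _ [set w]) aF.
rewrite !(plus_prob_eq _ (boost_restrict _ _ eE)) boost_influence //.
apply: eq_big_seq => v vl; have hE := hybrid_restrict v F eE.
by rewrite -(spin_ratio_eq (lW v vl) hE) -(plus_influence_eq _ _ hE).
Qed.

End Telescoping.

(** * Components, isomorphic copies and pinned vertices *)

Section Components.
Variables (R : realFieldType) (T : finType) (e : rel T).
Hypotheses (e_sym : symmetric e) (e_irr : irreflexive e).
Variables beta gamma : R.
Hypotheses (gamma_gt0 : 0 < gamma) (beta_ge0 : 0 <= beta).
Implicit Types (U W D : {set T}) (F : T -> bool -> R) (u v w x : T) (b c : bool).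

Local Notation Z := (partition_fun e beta gamma).
Local Notation boost := (boost beta gamma).

Lemma partition_fun_disjoint W W' F : [disjoint W & W'] ->
    (forall x y, x \in W -> y \in W' -> ~~ e x y) ->
  Z (W :|: W') F = Z W F * Z W' F.
Proof.
have [n] := ubnP #|W|; elim: n W F => // n IHn W F leWn dWW' nWW'.
have [->|[w wW]] := set_0Vmem W; first by rewrite partition_fun0 set0U mul1r.
have wW' : w \notin W' by rewrite (disjointFr dWW').
have UE : (W :|: W') :\ w = (W :\ w) :|: W'.
  by apply/setP => x; rewrite !inE; case: eqVneq => [->|//] /=; rewrite (negPf wW').
have WW'w b : Z ((W :|: W') :\ w) (boost (e w) b F) = Z (W :\ w) (boost (e w) b F) * Z W' F.
  rewrite UE IHn; first 1 last.
  - by move: leWn; rewrite (cardsD1 w) wW.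
  - by apply: disjointWl dWW'; rewrite subsetDl.
  - by move=> x y /setD1P[_]; apply: nWW'.
  congr (_ * _); apply: partition_fun_eq => x xW' c.
  by rewrite /boost (negPf (nWW' w x wW xW')) mulr1.
rewrite (partition_fun_peel _ _ _ _ _ (w := w)) ?inE ?wW // !WW'w.
by rewrite !mulrA -mulrDl -(partition_fun_peel _ _ _ _ _ wW).
Qed.

(** The partition function of the rest of U cancels in the ratio. *)
Lemma spin_ratio_component U W F w : admissible U F -> W \subset U -> w \in W ->
    (forall x y, x \in W -> y \in U :\: W -> ~~ e x y) ->
  spin_ratio e beta gamma U F w = spin_ratio e beta gamma W F w.
Proof.
move=> aF WU wW nW.
have swE b : spin_weight e beta gamma U F w b
           = spin_weight e beta gamma W F w b * Z (U :\: W) F.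
  rewrite /spin_weight -mulrA; congr (_ * _).
  have -> : U :\ w = (W :\ w) :|: (U :\: W).
    apply/setP => x; rewrite !inE; have [->|_] /= := eqVneq x w; first by rewrite wW.
    by have := subsetP WU x; case: (x \in W) => // ->.
  rewrite partition_fun_disjoint; first 1 last.
  - by rewrite disjoint_sym disjoints_subset; apply/subsetP => x; rewrite !inE => /andP[/negPf->]; rewrite andbF.
  - by move=> x y /setD1P[_]; apply: nW.
  congr (_ * _); apply: partition_fun_eq => x xW' c.
  by rewrite /boost (negPf (nW w x wW xW')) mulr1.
rewrite /spin_ratio !swE -mulf_div divff ?mulr1 //.
by apply/lt0r_neq0/partition_fun_gt0 => //; apply: admissible_sub (subsetDl _ _) aF.
Qed.

Lemma imset_setD1 (T' : finType) (g : T' -> T) (U : {set T'}) (w : T') :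
  injective g -> (g @: U) :\ g w = g @: (U :\ w).
Proof.
move=> g_inj.
apply/setP => x; rewrite !inE; apply/andP/imsetP => [[xw /imsetP[y yU xE]]|[y]].
  by exists y; rewrite // !inE yU andbT; apply: contraNneq xw => <-; rewrite xE.
by rewrite !inE => /andP[yw yU] ->; rewrite (inj_eq g_inj) yw imset_f.
Qed.

Lemma partition_fun_inj (T' : finType) (e' : rel T') (g : T' -> T) (U : {set T'}) F :
    symmetric e' -> irreflexive e' -> injective g ->
    (forall x y : T', e (g x) (g y) = e' x y) ->
  Z (g @: U) F = partition_fun e' beta gamma U (F \o g).
Proof.
move=> e'_sym e'_irr g_inj ge.
have [n] := ubnP #|U|; elim: n U F => // n IHn U F leUn.
have [->|[w wU]] := set_0Vmem U; first by rewrite imset0 !partition_fun0.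
rewrite (partition_fun_peel _ _ _ _ _ (imset_f g wU)) //.
rewrite (partition_fun_peel _ _ _ _ _ wU) // !imset_setD1 // !IHn; last first.
- by move: leUn; rewrite (cardsD1 w) wU.
- by move: leUn; rewrite (cardsD1 w) wU.
by congr (_ * _ + _ * _); apply: partition_fun_eq => x _ c; rewrite /boost /= ge.
Qed.

Lemma spin_ratio_inj (T' : finType) (e' : rel T') (g : T' -> T) (U : {set T'}) F (w : T') :
    symmetric e' -> irreflexive e' -> injective g ->
    (forall x y : T', e (g x) (g y) = e' x y) ->
  spin_ratio e beta gamma (g @: U) F (g w) = spin_ratio e' beta gamma U (F \o g) w.
Proof.
move=> e'_sym e'_irr g_inj ge.
have swE b : spin_weight e beta gamma (g @: U) F (g w) b
           = spin_weight e' beta gamma U (F \o g) w b.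
  rewrite /spin_weight imset_setD1 // (partition_fun_inj _ _ e'_sym) //; congr (_ * _).
  by apply: partition_fun_eq => x _ c; rewrite /boost /= ge.
by rewrite /spin_ratio !swE.
Qed.

Definition pin_set D (t : T -> bool) F x c : R :=
  if (x \in D) && (c != t x) then 0 else F x c.

(** The weights around D once D has been pinned to t and removed. *)
Definition absorb D (t : T -> bool) F x c : R :=
  F x c * \prod_(d in D) (if e d x && (c == t d) then coupling beta gamma c else 1).

Lemma admissible_absorb U D t F : admissible U F -> admissible U (absorb D t F).
Proof.
move=> aF x /aF[F0 F1]; rewrite /absorb; split.
  by rewrite mulr_gt0 // prodr_gt0 // => d _; case: ifP.
by rewrite mulr_ge0 // prodr_ge0 // => d _; case: ifP.
Qed.

(** Removing pinned vertices. The factor k does not see the weights of the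
    other vertices, and it can only vanish if two pinned vertices are adjacent. *)
Lemma partition_fun_pin_set U D t F : D \subset U ->
  exists2 k,
    {in D &, forall x y, ~~ e x y} -> (forall d, d \in D -> 0 < F d (t d)) -> 0 < k
  & forall F', (forall d, d \in D -> F' d =1 F d) ->
      Z U (pin_set D t F') = k * Z (U :\: D) (absorb D t F').
Proof.
have [n] := ubnP #|D|; elim: n U D F => // n IHn U D F leDn DU.
have [D0|[d dD]] := set_0Vmem D.
  exists 1 => [//|F' _]; rewrite mul1r D0 setD0; apply: partition_fun_eq => x _ c.
  by rewrite /pin_set /absorb big_set0 mulr1 inE.
have dU := subsetP DU d dD.
have [||k k_gt0 kE] := IHn (U :\ d) (D :\ d) (boost (e d) (t d) F).
- by move: leDn; rewrite (cardsD1 d) dD.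
- exact: setSD.
exists (F d (t d) * k) => [indD Fgt0|F' eqF].
  apply: mulr_gt0; first exact: Fgt0.
  apply: k_gt0 => [x y /setD1P[_ xD] /setD1P[_ yD]|x /setD1P[_ xD]].
    exact: indD.
  by rewrite /boost (negPf (indD d x dD xD)) mulr1 Fgt0.
have pinE x : x \in U :\ d -> boost (e d) (t d) (pin_set D t F') x
                        =1 pin_set (D :\ d) t (boost (e d) (t d) F') x.
  move=> /setD1P[xd _] c; rewrite /boost /pin_set !inE xd /=.
  by case: ifP; rewrite ?mul0r.
rewrite (partition_fun_peel _ _ _ _ _ dU) //.
have -> : pin_set D t F' d true * Z (U :\ d) (boost (e d) true (pin_set D t F'))
     + pin_set D t F' d false * Z (U :\ d) (boost (e d) false (pin_set D t F'))
     = F d (t d) * Z (U :\ d) (boost (e d) (t d) (pin_set D t F')).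
  by rewrite {1 3}/pin_set dD -eqF //; case: (t d); rewrite /= mul0r ?addr0 ?add0r.
rewrite (partition_fun_eq _ _ _ pinE) kE; last first.
  by move=> x /setD1P[_ xD] c; rewrite /boost eqF.
rewrite mulrA; have -> : (U :\ d) :\: (D :\ d) = U :\: D.
  by apply/setP => x; rewrite !inE; have [->|] /= := eqVneq x d; rewrite ?dD.
congr (_ * _); apply: partition_fun_eq => x _ c.
rewrite /absorb /boost [in RHS](big_setD1 d) //= mulrA.
by congr (_ * _ * _); case: eqVneq => [->|]; rewrite ?andbF.
Qed.
End Components.

(** * Conditional Gibbs measures as partition functions *)

Section GibbsPartition.
Variables (R : realType) (T : finType) (e : rel T).
Hypotheses (e_sym : symmetric e) (e_irr : irreflexive e).
Variables beta gamma lambda : R.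
Hypotheses (gamma_gt0 : 0 < gamma) (beta_ge0 : 0 <= beta) (lambda_gt0 : 0 < lambda).
Variables (D : {set T}) (t : T -> bool).

Local Notation Z := (partition_fun e beta gamma).
Local Notation config := {ffun T -> bool}.
Local Notation prob := (prob e beta gamma lambda).
Local Notation cprob := (cprob e beta gamma lambda).

Definition base_field (x : T) (c : bool) : R := if c then lambda else 1.

(** Weights of the Gibbs measure conditioned on the spins t on D, for the vertices
    outside D. *)
Definition pinned_field : T -> bool -> R := absorb e beta gamma D t base_field.

Lemma admissible_base U : admissible U base_field.
Proof. by move=> x _; rewrite /base_field ltr01 ltW. Qed.

Lemma admissible_pinned U : admissible U pinned_field.
Proof. exact/admissible_absorb/admissible_base. Qed.

Lemma inner_edges_forall (S : {set T}) (P : pred T) : (forall v, P v = (v \in S)) ->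
  [set d in edge_set e | [forall v in d, P v]] = inner_edges e S.
Proof.
move=> PE; apply/setP => d; rewrite !inE; congr (_ && _).
by apply/forall_inP/subsetP => H v /H; rewrite PE.
Qed.

Lemma sum_weight (A : {set config}) (f : T -> bool -> bool) :
    (forall s, (s \in A) = [forall x, f x (s x)]) ->
  \sum_(s in A) weight e beta gamma lambda s
  = Z setT (fun x c => if f x c then base_field x c else 0).
Proof.
move=> AE; rewrite /partition_fun big_mkcond /=.
rewrite (reindex (fun S : {set T} => [ffun x => x \in S])) /=; last first.
  exists (fun s : config => [set x | s x]) => [S|s] _.
    by apply/setP => x; rewrite inE ffunE.
  by apply/ffunP => x; rewrite ffunE inE.
apply: eq_big => [S|S _]; first by rewrite subsetT.
rewrite AE /weight.
rewrite (inner_edges_forall (S := S)) => [|v]; last by rewrite ffunE.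
rewrite (inner_edges_forall (S := setT :\: S)) => [|v]; last by rewrite ffunE !inE andbT.
case: ifPn => [/forallP fS|].
  congr (_ * _ * _); rewrite -prodr_const big_mkcond /=.
  rewrite [RHS](eq_bigl predT) => [|x]; last by rewrite inE.
  by apply: eq_bigr => x _; rewrite inE; have := fS x; rewrite ffunE => ->.
rewrite negb_forall => /existsP[x]; rewrite ffunE => /negPf fx.
by rewrite (big_setD1 x) ?inE //= fx !mul0r.
Qed.

Lemma sum_weight_gt0 : 0 < \sum_s weight e beta gamma lambda s.
Proof.
have -> : \sum_s weight e beta gamma lambda s = \sum_(s in [set: config]) weight e beta gamma lambda s.
  by apply: eq_bigl => s; rewrite inE.
rewrite (sum_weight (f := fun _ _ => true)) => [|s].
  by apply: partition_fun_gt0 => //; apply: admissible_base.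
by rewrite inE; apply/esym/forallP.
Qed.

(** The Gibbs weight of an event that fixes the spins of D, up to a factor that
    is common to all such events. *)
Lemma prob_pinned : exists2 k,
    {in D &, forall x y, ~~ e x y} -> 0 < k
  & forall (A : {set config}) (f : T -> bool -> bool),
      (forall s, (s \in A) = (s \in agreeing D t) && [forall x, f x (s x)]) ->
      (forall x c, x \in D -> f x c) ->
      prob A = k * Z (~: D) (fun x c => if f x c then pinned_field x c else 0).
Proof.
have [k k_gt0 kE] := partition_fun_pin_set e_sym e_irr beta gamma t base_field (subsetT D).
exists (k / \sum_s weight e beta gamma lambda s) => [indD|A f AE fD].
  rewrite divr_gt0 ?sum_weight_gt0 // k_gt0 // => d _.
  by rewrite /base_field; case: (t d).
rewrite /Defs.prob -mulr_suml mulrAC; congr (_ / _).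
rewrite (sum_weight (f := fun x c => f x c && ((x \in D) ==> (c == t x)))) => [|s].
  rewrite (@partition_fun_eq _ _ _ _ _ _ _ (pin_set D t (fun x c => if f x c then base_field x c else 0))).
    rewrite kE => [|d dD c]; last by rewrite fD.
    rewrite setTD; congr (_ * _); apply: partition_fun_eq => x _ c.
    by rewrite /pinned_field /absorb; case: ifP => _; rewrite ?mul0r.
  move=> x _ c; rewrite /pin_set; case: (boolP (x \in D)) => xD /=; last by rewrite andbT.
  by rewrite fD //=; case: eqP.
rewrite AE inE; apply/andP/forallP => [[/forall_inP sD /forallP fs] x|H].
  by rewrite fs; apply/implyP/sD.
split; first by apply/forall_inP => x xD; have /andP[_ /implyP] := H x; apply.
by apply/forallP => x; have /andP[] := H x.
Qed.

Lemma partition_fun_pin1 (U : {set T}) F w b : w \in U ->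
  Z U (pin w b F) = spin_weight e beta gamma U F w b.
Proof.
move=> wU; rewrite (partition_fun_peel_off _ _ _ _ (F := F) wU) //.
  by rewrite /pin eqxx; case: b; rewrite /= mul0r ?addr0 ?add0r.
by move=> x /setD1P[/negPf xw _] c; rewrite /pin xw.
Qed.

(** When the conditioning is on an event of probability zero, the first
    alternative holds by convention. *)
Lemma influenceE w u : w \notin D -> u \notin D ->
  influence e beta gamma lambda D t w u = 0 \/
  influence e beta gamma lambda D t w u
  = plus_influence e beta gamma (~: D) pinned_field w u.
Proof.
move=> wD uD; rewrite /influence /=.
set C := fun b => (agreeing D t :&: spin_at w b)%SET.
have [|/norP[C1 C0]] := boolP (_ || _); [by left | right].
have [k _ kE] := prob_pinned.
have wU : w \in ~: D by rewrite inE.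
have CE b : prob (C b) = k * spin_weight e beta gamma (~: D) pinned_field w b.
  rewrite (kE _ (fun x c => (x == w) ==> (c == b))) => [|s|x c xD].
  - congr (_ * _); rewrite -partition_fun_pin1 //; apply: partition_fun_eq => x _ c.
    by rewrite /pin; case: (x == w); case: (c == b).
  - rewrite !inE; congr (_ && _); apply/eqP/forallP => [sw x|/(_ w)].
      by apply/implyP => /eqP->; apply/eqP.
    by rewrite eqxx => /eqP.
  - by case: eqP xD wD => // -> ->.
have NE b : prob (spin_at u true :&: C b)%SET = k * Z (~: D) (pin u true (pin w b pinned_field)).
  rewrite (kE _ (fun x c => ((x == w) ==> (c == b)) && ((x == u) ==> c))) => [|s|x c xD].
  - congr (_ * _); apply: partition_fun_eq => x _ c.
    by rewrite /pin; case: (x == w); case: (x == u); case: b; case: c.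
  - rewrite !inE andbCA; congr (_ && _); apply/andP/forallP => [[/eqP su /eqP sw] x|H].
      by apply/andP; split; apply/implyP => /eqP->; rewrite ?su ?sw.
    by have := H u; have := H w; rewrite !eqxx /= => /andP[-> _] /andP[_ ->].
  - have -> : x == w = false by apply: contraNF wD => /eqP<-.
    by have -> : x == u = false by apply: contraNF uD => /eqP<-.
have sw_neq0 b : prob (C b) != 0 -> k != 0 /\ spin_weight e beta gamma (~: D) pinned_field w b != 0.
  by rewrite CE mulf_eq0 negb_or => /andP.
have [k0 w1] := sw_neq0 _ C1; have [_ w0] := sw_neq0 _ C0.
have cE b : spin_weight e beta gamma (~: D) pinned_field w b != 0 ->
   cprob (spin_at u true) (C b) =
   if u == w then b%:R else plus_prob e beta gamma (~: D :\ w) (boost beta gamma (e w) b pinned_field) u.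
  move=> wb; rewrite /cprob NE CE -mulf_div divff // mul1r.
  case: eqVneq => [->|uw].
    have -> : Z (~: D) (pin w true (pin w b pinned_field)) = b%:R * spin_weight e beta gamma (~: D) pinned_field w b.
      rewrite -partition_fun_pin1 // (partition_fun_peel_off _ _ _ _ (F := pinned_field) wU) //.
        rewrite [in RHS](partition_fun_peel_off _ _ _ _ (F := pinned_field) wU) //.
          by rewrite /pin eqxx; case: b {wb}; rewrite /= !(mul0r, addr0, add0r) ?mul1r.
        by move=> x /setD1P[/negPf xw _] c; rewrite /pin xw.
      by move=> x /setD1P[/negPf xw _] c; rewrite /pin xw.
    by rewrite mulfK.
  rewrite (partition_fun_peel_off _ _ _ _ (F := pin u true pinned_field) wU) //; last first.
    by move=> x /setD1P[/negPf xw _] c; rewrite /pin xw.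
  have boost_pin b' : Z (~: D :\ w) (boost beta gamma (e w) b' (pin u true pinned_field))
       = Z (~: D :\ w) (pin u true (boost beta gamma (e w) b' pinned_field)).
    by apply: partition_fun_eq => x _ c; rewrite /pin /boost; case: ifP => _; rewrite ?mul0r.
  have pin_w c : pin u true (pin w b pinned_field) w c = if c == b then pinned_field w b else 0.
    by rewrite /pin [w == u]eq_sym (negPf uw) eqxx /=; case: eqP => // ->.
  move: wb; rewrite /plus_prob /spin_weight !boost_pin !pin_w mulf_eq0 negb_or.
  by case: b {pin_w} => /= /andP[f0 z0];
    rewrite !(mul0r, addr0, add0r) -mulf_div divff // mul1r.
rewrite !cE // /plus_influence; case: ifP => _ //=.
by rewrite subr0.
Qed.

(** Pairwise non-adjacent pinned vertices never have probability zero, so the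
    conditional marginals at v are genuine. *)
Lemma pinned_marginal v (B : {set config}) (A : bool -> {set config}) :
    v \notin D -> {in D &, forall x y, ~~ e x y} ->
    B = agreeing D t -> (forall b, A b = spin_at v b) ->
  cprob (A false) B != 0 /\
  cprob (A true) B / cprob (A false) B = spin_ratio e beta gamma (~: D) pinned_field v.
Proof.
move=> vD indD BE AE; have [k k_gt0 kE] := prob_pinned.
have k0 : k != 0 by rewrite lt0r_neq0 // k_gt0.
have vU : v \in ~: D by rewrite inE.
have [w0 w1] := spin_weight_gt0 e_sym e_irr gamma_gt0 beta_ge0 vU (@admissible_pinned (~: D)).
have B0 : prob B != 0.
  rewrite (kE _ (fun _ _ => true)) => // [|s].
    rewrite mulf_neq0 //; apply/lt0r_neq0/partition_fun_gt0 => //.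
    exact: admissible_pinned.
  by rewrite BE; apply/esym/andb_idr => _; apply/forallP.
have ABE b : prob (A b :&: B)%SET = k * spin_weight e beta gamma (~: D) pinned_field v b.
  rewrite (kE _ (fun x c => (x == v) ==> (c == b))) => [|s|x c xD].
  - congr (_ * _); rewrite -partition_fun_pin1 //; apply: partition_fun_eq => x _ c.
    by rewrite /pin; case: (x == v); case: (c == b).
  - rewrite inE andbC BE AE !inE; congr (_ && _); apply/eqP/forallP => [sw x|/(_ v)].
      by apply/implyP => /eqP->; apply/eqP.
    by rewrite eqxx => /eqP.
  - by case: eqP xD vD => // -> ->.
have sw0 := lt0r_neq0 w0; rewrite /cprob !ABE; split.
  by apply: mulf_neq0; [apply: mulf_neq0 | rewrite invr_eq0].
by rewrite /spin_ratio; field; rewrite k0 B0 sw0.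
Qed.

End GibbsPartition.

(** * The pinned spins seen along a self-avoiding walk *)

Section WalkFields.
Variables (R : realType) (disp : Order.disp_t) (V : finOrderType disp) (e : rel V).
Hypotheses (e_sym : symmetric e) (e_irr : irreflexive e).
Variables beta gamma lambda : R.
Hypotheses (gamma_gt0 : 0 < gamma) (beta_ge0 : 0 <= beta) (lambda_gt0 : 0 < lambda).
Variables (L : {set V}) (tau : V -> bool).
Implicit Types (p q s : seq V) (u v w x y : V) (c : bool).

Local Notation walk := (#|V|.+1.-bseq V).
Local Notation boundary := (boundary L tau).
Local Notation coupling := (coupling beta gamma).

Lemma is_walk_rcons2 q w v : is_walk e (rcons (rcons q w) v) = is_walk e (rcons q w) && e w v.
Proof. by case: q => [|x q] /=; rewrite ?andbT // rcons_path last_rcons. Qed.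

Lemma closing_rcons q v : closing (rcons q v) = uniq q && (index v q + 3 <= size q)%N.
Proof.
case: q => [|x q] //=.
by rewrite last_rcons belast_rcons size_rcons.
Qed.

Lemma boundary_rcons2 q w v : boundary (rcons (rcons q w) v) =
  if v \in L then Some (tau v)
  else if uniq (rcons q w) && (index v (rcons q w) + 2 <= size q)%N
       then Some (nth v (rcons q w) (index v (rcons q w)).+1 < w)%O
       else None.
Proof.
case: q => [|x q]; first by rewrite /Defs.boundary /= /closing /= addn3 addn2.
rewrite /Defs.boundary; set p := rcons (rcons (x :: q) w) v.
have -> : p = x :: rcons (rcons q w) v by [].
rewrite last_rcons belast_rcons; case: ifP => // _.
rewrite -[x :: rcons (rcons q w) v]/(rcons (rcons (x :: q) w) v) closing_rcons.
rewrite !size_rcons -[x :: rcons q w]/(rcons (x :: q) w); set j := index v _.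
rewrite addn3 ltnS addn2; case: ifP => // /andP[uq ji]; congr Some.
have -> : nth x (rcons (rcons (x :: q) w) v) (size q).+1 = w.
  have nw : nth x (rcons (x :: q) w) (size (x :: q)) = w by rewrite nth_rcons ltnn eqxx.
  by rewrite nth_rcons size_rcons ltnSn; exact: nw.
have js : (j.+1 < size (rcons (x :: q) w))%N by rewrite size_rcons ltnS ltnW.
rewrite nth_rcons js (set_nth_default v) // -leNgt le_eqVlt.
suff -> : nth v (rcons (x :: q) w) j.+1 == w = false by [].
have {2}-> : w = nth v (rcons (x :: q) w) (size (x :: q)) by rewrite nth_rcons ltnn eqxx.
by rewrite nth_uniq // ?size_rcons ?ltnSn // ltn_eqF.
Qed.

(** The pinned copies of visited vertices around an unvisited vertex x, when the
    walk p has been followed: a copy of the vertex v of p has the spin of the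
    closing walk that would return to v from x, and x is not joined to the copy
    of v when p leaves v for x. *)
Definition revisit p v x c : bool :=
  [&& (index v p).+1 < size p, e v x, x != nth v p (index v p).+1
    & c == (nth v p (index v p).+1 < x)%O]%N.

Definition walk_field p x c : R :=
  pinned_field e beta gamma lambda L tau x c
  * \prod_v (if revisit p v x c then coupling c else 1).

Lemma admissible_walk p (U : {set V}) : admissible U (walk_field p).
Proof.
have aP := admissible_pinned e gamma_gt0 beta_ge0 lambda_gt0 L tau.
move=> x /(aP U)[F0 F1]; rewrite /walk_field; split.
  by rewrite mulr_gt0 // prodr_gt0 // => d _; case: ifP.
by rewrite mulr_ge0 // prodr_ge0 // => d _; case: ifP.
Qed.

Lemma walk_field1 r : walk_field [:: r] =2 pinned_field e beta gamma lambda L tau.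
Proof.
move=> x c; rewrite /walk_field big1 ?mulr1 // => v _.
Qed.

(** Following the walk by one more vertex is one step of the telescoping. *)
Lemma walk_field_rcons q w v x c : uniq (rcons q w) -> v \notin rcons q w ->
  walk_field (rcons (rcons q w) v) x c
  = hybrid beta gamma <%O (e w) v (walk_field (rcons q w)) x c.
Proof.
move=> uq vq; rewrite /hybrid /boost /walk_field -!mulrA /=; do 2![congr (_ * _)].
set p := rcons q w in uq vq *.
have wp : index w p = size q.
  rewrite /p -cats1 index_cat /= eqxx addn0.
  by move: uq; rewrite rcons_uniq => /andP[/negPf-> _].
rewrite [LHS](bigD1 w) //= [X in _ = X * _](bigD1 w) //=.
have -> : revisit p w x c = false by rewrite /revisit wp /p size_rcons ltnn.
have -> : revisit (rcons p v) w x c = [&& e w x, x != v & c == (v < x)%O].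
  rewrite /revisit -[rcons p v]cats1 index_cat mem_rcons inE eqxx wp.
  by rewrite cats1 size_rcons /p size_rcons ltnSn nth_rcons size_rcons ltnn eqxx.
rewrite mul1r [RHS]mulrC; congr (_ * _).
  rewrite -!andbA; case: (e w x) => /=; last by rewrite mulr1.
  by case: (ltgtP x v) => //=; case: c; rewrite ?mulr1 ?mul1r.
apply: eq_bigr => y yw; congr (if _ then _ else _).
rewrite /revisit -[rcons p v]cats1 index_cat cats1 size_rcons.
case: ifPn => yp.
  have ip : ((index y p).+1 < size p)%N.
    rewrite ltn_neqAle index_mem yp andbT /p size_rcons eqSS -wp.
    by apply: contra yw => /eqP E; rewrite -(nth_index w yp) E nth_index // mem_rcons inE eqxx.
  by rewrite ltnS ltnW // ip nth_rcons ip.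
rewrite (memNindex yp) ltnS [((size p).+1 < size p)%N]ltnNge leqnSn /=.
by rewrite ltnNge leq_addr.
Qed.

(** The weights at a vertex p of the tree of self-avoiding walks, once the children
    of p that carry a boundary condition have been absorbed. *)
Definition tree_field p c : R :=
  (if c then lambda else 1)
  * \prod_v (if is_walk e (rcons p v) && (boundary (rcons p v) == Some c)
             then coupling c else 1).

(** The pinned children of a walk are the copies of pinned vertices that its end
    sees: the vertices of L, and the vertices visited before with the spin given
    by the order. The vertex visited just before the end is the case of equality
    in [revisit]; on the tree, it is the absence of backtracking. *)
Lemma tree_field_walk q w c : is_walk e (rcons q w) -> uniq (rcons q w) ->
    all (fun v => v \notin L) (rcons q w) ->
  tree_field (rcons q w) c = walk_field (rcons q w) w c.
Proof.
move=> wq uq /allP Lq; rewrite /tree_field /walk_field /pinned_field /absorb -mulrA.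
congr (_ * _); rewrite [X in _ = X * _]big_mkcond -big_split /=; apply: eq_bigr => v _.
rewrite is_walk_rcons2 wq boundary_rcons2 uq /= [e w v]e_sym.
have [vL|vL] := boolP (v \in L).
  have -> : revisit (rcons q w) v w c = false.
    have /negPf-> // : ~~ revisit (rcons q w) v w c.
    rewrite /revisit; apply/negP => /and4P[iv _ _ _].
    have : v \in rcons q w by rewrite -index_mem ltnW.
    by move/Lq; rewrite vL.
  by rewrite mulr1 (inj_eq Some_inj) eq_sym.
rewrite mul1r; congr (if _ then _ else _); rewrite /revisit andbCA; congr (_ && _).
set j := index v _; rewrite size_rcons ltnS addn2.
case: ifPn => ji; last first.
  apply/esym/negbTE/negP => /and3P[jq wn _].
  have j1q : j.+1 = size q by lia.
  by move: wn; rewrite j1q nth_rcons ltnn eqxx eqxx.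
rewrite (ltnW ji) (inj_eq Some_inj) [_ == c]eq_sym /=; apply/esym/andb_idl => _.
have {1}-> : w = nth v (rcons q w) (size q) by rewrite nth_rcons ltnn eqxx.
by rewrite nth_uniq // ?size_rcons ?ltnSn // ?ltnS 1?ltnW // gtn_eqF.
Qed.

End WalkFields.

(** * The tree of self-avoiding walks *)

Section WalkTree.
Variables (R : realType) (disp : Order.disp_t) (V : finOrderType disp) (e : rel V).
Hypotheses (e_sym : symmetric e) (e_irr : irreflexive e).
Variables beta gamma lambda : R.
Hypotheses (gamma_gt0 : 0 < gamma) (beta_ge0 : 0 <= beta) (lambda_gt0 : 0 < lambda).
Variables (L : {set V}) (tau : V -> bool).
Implicit Types (u v w x y : V) (c : bool).

Local Notation walk := (#|V|.+1.-bseq V).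
Local Notation boundary := (boundary L tau).
Local Notation coupling := (coupling beta gamma).
Local Notation SAW_avoiding := (SAW_avoiding e L).
Local Notation tree_field := (tree_field e beta gamma lambda L tau).
Local Notation walk_field := (walk_field e beta gamma lambda L tau).

Definition tree_rel : rel walk := fun p q => extends p q || extends q p.

Definition below (z : walk) : {set walk} := [set p in SAW_avoiding | prefix z p].

(** The default value p only occurs when p already has maximal size. *)
Definition grow (p : walk) v : walk := insubd p (rcons p v).

Lemma extendsP (T : finType) (p q : seq T) : reflect (exists v : T, q = rcons p v) (extends p q).
Proof. by apply: (iffP existsP) => -[v /eqP]; exists v => //; apply/eqP. Qed.

Lemma size_extends (p q : seq V) : extends p q -> size q = (size p).+1.
Proof. by case/extendsP => v ->; rewrite size_rcons. Qed.

Lemma tree_rel_sym : symmetric tree_rel.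
Proof. by move=> p q; rewrite /tree_rel orbC. Qed.

Lemma tree_rel_irr : irreflexive tree_rel.
Proof.
by move=> p; rewrite /tree_rel orbb; apply/negbTE/negP => /size_extends/eqP; rewrite ltn_eqF.
Qed.

Lemma prefix_rconsr (s p : seq V) v : prefix s (rcons p v) = prefix s p || (s == rcons p v).
Proof.
apply/idP/orP => [/prefixP[t]|[/prefixP[t ->]|/eqP->]]; last exact: prefix_refl.
  case/lastP: t => [|t x]; first by rewrite cats0 => ->; right.
  by rewrite -rcons_cat => /rcons_inj[-> _]; left; apply: prefix_prefix.
by rewrite rcons_cat prefix_prefix.
Qed.

Lemma SAW_avoidingP (p : walk) :
  reflect [/\ is_walk e p, uniq p & all (fun v => v \notin L) p] (p \in SAW_avoiding).
Proof. by rewrite inE; apply: and3P. Qed.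

Lemma SAW_avoiding_size (p : walk) : p \in SAW_avoiding -> (size p <= #|V|)%N.
Proof. by case/SAW_avoidingP => _ /card_uniqP <- _; apply: max_card. Qed.

Lemma growE (p : walk) v : p \in SAW_avoiding -> grow p v = rcons p v :> seq V.
Proof. by move=> /SAW_avoiding_size sp; rewrite /grow val_insubd size_rcons ltnS sp. Qed.

Lemma SAW_avoiding_nil (p : walk) : p \in SAW_avoiding -> exists q w, p = rcons q w :> seq V.
Proof.
case/SAW_avoidingP; case/lastP: (p : seq V) => // q w _ _ _; by exists q, w.
Qed.

Lemma is_walk_cat (p q : seq V) : p != [::] -> is_walk e (p ++ q) -> is_walk e p.
Proof. by case: p => // x p _ /=; rewrite cat_path => /andP[]. Qed.

Lemma SAW_avoiding_prefix (p q : walk) : p \in SAW_avoiding -> prefix q p -> q != [::] :> seq V ->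
  q \in SAW_avoiding.
Proof.
move=> /SAW_avoidingP[wp up Lp] /prefixP[s pE] q0; apply/SAW_avoidingP.
move: wp up Lp; rewrite pE cat_uniq all_cat => /is_walk_cat -> //.
by case/and3P => -> _ _ /andP[->].
Qed.

Lemma boundary_free (q : seq V) w :
  (boundary (rcons q w) == None) = (w \notin L) && ~~ closing (rcons q w).
Proof.
case E: (rcons q w) => [|x s]; first by case: (q) E.
have xs : last x s = w by have := last_rcons x q w; rewrite E.
by rewrite /Defs.boundary xs; case: (w \in L) => //; case: ifP.
Qed.

Lemma uniq_closing (p : seq V) : uniq p -> closing p = false.
Proof.
case/lastP: p => // q w; rewrite rcons_uniq closing_rcons => /andP[wq _].
by apply/negbTE; rewrite negb_and memNindex // addn3 -ltnNge ltnS leqW ?orbT // leqW.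
Qed.

Lemma SAW_avoiding_boundary (p : walk) : p \in SAW_avoiding -> boundary p = None.
Proof.
move=> pS; have [q [w pE]] := SAW_avoiding_nil pS.
have /SAW_avoidingP[_ up Lp] := pS; apply/eqP; move: up Lp; rewrite pE => up /allP Lp.
by rewrite boundary_free uniq_closing // Lp // mem_rcons inE eqxx.
Qed.

Lemma SAW_boundary (p : walk) : p \in SAW e -> boundary p = None ->
  [/\ is_walk e p, uniq p & forall q w, p = rcons q w :> seq V -> w \notin L].
Proof.
rewrite inE => /andP[wp cp] /eqP bp; split=> // [|q w pE].
  case/lastP E : (p : seq V) => [//|q w].
  by move: bp cp; rewrite E boundary_free => /andP[_ /negPf->]; rewrite orbF.
by move: bp; rewrite pE boundary_free => /andP[].
Qed.

Lemma SAW_avoiding_SAW (p : walk) : p \in SAW_avoiding -> p \in SAW e.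
Proof. by case/SAW_avoidingP => wp up _; rewrite inE wp up. Qed.

(** Without a boundary condition at p and at the vertices between z and p, the
    walk p has no repetition and does not enter L. *)
Lemma subtree_free (z p : walk) : z \in SAW_avoiding ->
  (p \in subtree e L tau z) && (boundary p == None) = (p \in below z).
Proof.
move=> zS; have [_ _ Lz] := SAW_avoidingP _ zS.
have [zq [zw zE]] := SAW_avoiding_nil zS.
rewrite [p \in below z]inE; apply/andP/andP => [[]|[pS zp]].
  rewrite inE => /and3P[pS zp /forall_inP pq] /eqP bp.
  have [wp up lp] := SAW_boundary pS bp; split=> //; apply/SAW_avoidingP; split=> //.
  apply/allP => x xp; case/prefixP: (zp) => s pE.
  have [xz|xz] := boolP (x \in (z : seq V)); first exact: (allP Lz).
  have xs : x \in s by move: xp; rewrite pE mem_cat (negPf xz).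
  case/splitPr: xs pE => s1 s2 pE.
  have sq : (size (rcons (z ++ s1) x) <= #|V|.+1)%N.
    apply: leq_trans (size_bseq p); rewrite pE catA -cat_rcons size_cat.
    exact: leq_addr.
  pose q : walk := Bseq sq.
  have qp : prefix q p by rewrite pE catA -cat_rcons prefix_prefix.
  have zq' : prefix z q by rewrite /= rcons_cat prefix_prefix.
  have [E|qNp] := eqVneq q p; first by apply: (lp (z ++ s1)); rewrite -E.
  have qS : q \in SAW e.
    rewrite inE; move: wp up; rewrite pE catA -cat_rcons cat_uniq => wp /and3P[-> _ _].
    by rewrite (is_walk_cat _ wp) // -size_eq0 size_rcons.
  have := pq q qS; rewrite zq' qp qNp /= => /eqP bq.
  by have [_ _] := SAW_boundary qS bq; apply.
rewrite inE SAW_avoiding_SAW // zp SAW_avoiding_boundary //; split=> //=.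
apply/forall_inP => q qS; apply/implyP => /and3P[zq' qp _].
rewrite SAW_avoiding_boundary //; apply: SAW_avoiding_prefix pS qp _.
by case/prefixP: zq' => s ->; rewrite zE -size_eq0 size_cat size_rcons.
Qed.

(** Pruning turns the vertices with a boundary condition into leaves, so the parent
    of such a vertex has none. *)
Lemma subtree_pinned (z d : walk) : z \in SAW_avoiding ->
  d \in subtree e L tau z -> boundary d != None ->
  exists2 p, p \in below z & exists v, d = rcons p v :> seq V.
Proof.
move=> zS dz bd; have [zq [zw zE]] := SAW_avoiding_nil zS.
have := dz; rewrite inE => /and3P[dS zd /forall_inP dq].
case/lastP E : (d : seq V) => [|s v].
  by move: zd; rewrite E zE; case: (zq).
have sz : (size s <= #|V|.+1)%N.
  by rewrite -ltnS -(size_rcons s v) -E ltnW // ltnS size_bseq.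
pose p : walk := Bseq sz; exists p; last by exists v.
have zp : prefix z p.
  move: zd; rewrite E prefix_rconsr => /orP[//|/eqP zd].
  by move: bd; rewrite E -zd SAW_avoiding_boundary.
have pd : prefix p d by rewrite E prefix_rconsr /= prefix_refl.
rewrite -subtree_free // inE zp.
have pNd : p != d.
  by apply/eqP => pd'; have := congr1 (size \o val) pd'; rewrite /= E size_rcons => /eqP; rewrite ltn_eqF.
have p0 : p != [::] :> seq V.
  by case/prefixP: zp => t ->; rewrite zE -size_eq0 size_cat size_rcons.
have pS : p \in SAW e.
  move: dS; rewrite !inE E => /andP[wd cd]; apply/andP; split.
    by apply: (@is_walk_cat _ [:: v]) => //; rewrite cats1.
  case/orP: cd; first by rewrite rcons_uniq /= => /andP[_ ->].
  by rewrite closing_rcons => /andP[/= -> _].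
rewrite pS; apply/andP; split; last by have := dq p pS; rewrite zp pd pNd.
apply/forall_inP => q qS; apply/implyP => /and3P[zq' qp qNp].
have := dq q qS; rewrite zq' (prefix_trans qp pd) /=.
suff -> : q != d by [].
by apply/eqP => qd; move: (size_prefix qp); rewrite qd /= E size_rcons ltnn.
Qed.

Lemma child_subtree (z p d : walk) v : z \in SAW_avoiding -> p \in below z ->
    d = rcons p v :> seq V -> is_walk e d -> boundary d != None ->
  d \in subtree e L tau z.
Proof.
move=> zS; rewrite inE => /andP[pS zp] dE wd bd.
have up : uniq p by case/SAW_avoidingP: pS.
have [zq [zw zE]] := SAW_avoiding_nil zS.
have dS : d \in SAW e.
  rewrite inE wd; move: bd; rewrite dE boundary_free rcons_uniq up andbT negb_and !negbK.
  case/orP => [vL|->]; last by rewrite orbT.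
  suff -> : v \notin (p : seq V) by [].
  by case/SAW_avoidingP: pS => _ _ /allP Lp; apply/negP => /Lp; rewrite vL.
rewrite inE dS dE prefix_rconsr zp /=.
apply/forall_inP => q qS; apply/implyP => /and3P[zq' qd qNd].
have qp : prefix q p.
  move: qd; rewrite prefix_rconsr => /orP[//|/eqP qd].
  by case/eqP: qNd; apply: val_inj; rewrite /= qd dE.
rewrite SAW_avoiding_boundary //; apply: SAW_avoiding_prefix pS qp _.
by case/prefixP: zq' => s ->; rewrite zE -size_eq0 size_cat size_rcons.
Qed.

Lemma admissible_tree (U : {set walk}) : admissible U tree_field.
Proof.
move=> p _; rewrite /tree_field; split.
  by rewrite mul1r prodr_gt0 // => d _; case: ifP.
by rewrite mulr_ge0 ?(ltW lambda_gt0) // prodr_ge0 // => d _; case: ifP.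
Qed.

(** The marginals of the tree of self-avoiding walks at z are those of the tree
    of its free vertices, once the pinned leaves have been absorbed. *)
Lemma ratio_below z : z \in SAW_avoiding ->
  Defs.ratio e beta gamma lambda L tau z
  = (spin_ratio tree_rel beta gamma (below z) tree_field z)%:E.
Proof.
move=> zS; set ST := subtree_vertex e L tau z.
pose D : {set ST} := [set d : ST | boundary (val d : walk) != None].
pose t (d : ST) := odflt false (boundary (val d : walk)).
have srel_sym : symmetric (@subtree_rel _ _ e L tau z).
  by move=> x y; rewrite /subtree_rel orbC.
have srel_irr : irreflexive (@subtree_rel _ _ e L tau z).
  by move=> x; exact: tree_rel_irr.
have zz : (z \in subtree e L tau z) && (boundary z == None).
  by rewrite subtree_free // inE zS prefix_refl.
have [zT /eqP bz] := andP zz.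
pose zv : ST := Sub z zT.
have free (p : ST) : p \notin D = (val p \in below z).
  by rewrite inE negbK -subtree_free // (valP p).
have indD : {in D &, forall x y : ST, ~~ @subtree_rel _ _ e L tau z x y}.
  have half (x y : ST) : x \in D -> ~~ extends (val x : walk) (val y : walk) || (y \notin D).
    move=> xD; rewrite -implybE; apply/implyP => /extendsP[v yE].
    apply/negP => yD; have := yD; rewrite inE.
    case/(subtree_pinned zS (valP y)) => p; rewrite -subtree_free // => /andP[_ bp] [v'].
    rewrite yE => /rcons_inj[/val_inj xp _].
    by move: xD bp; rewrite inE -xp => /negP.
  move=> x y xD yD; rewrite /subtree_rel negb_or.
  by have := half x y xD; have := half y x yD; rewrite xD yD !orbF => -> ->.
have [|||m0 mE] := @pinned_marginal R ST (@subtree_rel _ _ e L tau z) srel_sym srel_irr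
    beta gamma lambda gamma_gt0 beta_ge0 lambda_gt0 D t zv
    (subtree_boundary e L tau z) (subtree_root_spin e L tau z) _ indD.
- by rewrite inE bz.
- apply/setP => s; rewrite !inE; apply/forallP/forall_inP => [H d|H d].
    by have := H d; rewrite inE /t; case: (boundary (val d : walk)).
  by have := H d; rewrite inE /t; case: (boundary (val d : walk)) => // b; apply.
- move=> b; apply/setP => s; rewrite !inE; apply/forallP/eqP => [H|H d].
    by apply/eqP; have /implyP := H zv; apply.
  by apply/implyP => /eqP dz; rewrite -H; apply/eqP; congr (s _); apply: val_inj.
rewrite /Defs.ratio (negPf m0) mE; congr (_%:E).
have -> : below z = val @: (~: D).
  apply/setP => p; apply/idP/imsetP => [pz|[d dD ->]]; last by rewrite -free -in_setC.
  have := pz; rewrite -subtree_free // => /andP[pT _].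
  by exists (Sub p pT); rewrite // inE free.
transitivity (spin_ratio (@subtree_rel _ _ e L tau z) beta gamma (~: D)
                (fun d => tree_field (val d : walk)) zv); last first.
  exact: (esym (spin_ratio_inj tree_rel_sym tree_rel_irr beta gamma (~: D) tree_field zv
    srel_sym srel_irr val_inj (fun _ _ => erefl))).
apply: spin_ratio_eq; first by rewrite inE free -subtree_free.
move=> p; rewrite inE free => pz c /=.
rewrite /pinned_field /absorb /tree_field /base_field; congr (_ * _).
rewrite -big_mkcondr -big_mkcond /= !prodr_const; congr (_ ^+ _).
have pS : val p \in SAW_avoiding by move: pz; rewrite inE => /andP[].
rewrite -(card_imset _ val_inj).
have grow_inj : injective (grow (val p)).
  by move=> x y /(congr1 val); rewrite /= !growE // => /rcons_inj[].
rewrite -[RHS](card_imset _ grow_inj); congr #|pred_of_set _|; apply/setP => d.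
apply/imsetP/imsetP => [[d' + ->]|[v + ->]]; rewrite unfold_in.
  case/andP => dD /andP[dp /eqP ct].
  have := dD; rewrite inE => bd.
  have pd : extends (val p : walk) (val d' : walk).
    case/orP: dp => // /extendsP[v pE].
    have [q _ [w dE]] := subtree_pinned zS (valP d') bd.
    move: bd; rewrite SAW_avoiding_boundary //; apply: SAW_avoiding_prefix pS _ _.
      by rewrite pE prefix_rconsr prefix_refl.
    by rewrite dE -size_eq0 size_rcons.
  case/extendsP: pd => v dE; exists v; last by apply: val_inj; rewrite /= growE.
  rewrite unfold_in -dE; have := valP d'; rewrite inE => /andP[+ _].
  rewrite inE => /andP[-> _] /=.
  by move: bd ct; rewrite /t; case: (boundary _) => // b _ ->.
case/andP => wv /eqP bv.
have gE : grow (val p) v = rcons (val p : walk) v :> seq V by apply: growE.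
have gT : grow (val p) v \in subtree e L tau z.
  by apply: (child_subtree zS pz gE); rewrite gE ?bv.
exists (Sub (grow (val p) v) gT) => //; rewrite unfold_in inE /t /= gE bv eqxx andbT /=.
by rewrite /subtree_rel /= gE; apply/orP; right; apply/extendsP; exists v.
Qed.

End WalkTree.

(** * Influences are sums over self-avoiding walks *)

Section WalkExpansion.
Variables (R : realType) (disp : Order.disp_t) (V : finOrderType disp) (e : rel V).
Hypotheses (e_sym : symmetric e) (e_irr : irreflexive e).
Variables beta gamma lambda : R.
Hypotheses (gamma_gt0 : 0 < gamma) (beta_ge0 : 0 <= beta) (lambda_gt0 : 0 < lambda).
Variables (L : {set V}) (tau : V -> bool).
Implicit Types (q s : seq V) (u v w x y : V) (c : bool).

Local Notation walk := (#|V|.+1.-bseq V).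
Local Notation SAW_avoiding := (SAW_avoiding e L).
Local Notation tree_field := (tree_field e beta gamma lambda L tau).
Local Notation walk_field := (walk_field e beta gamma lambda L tau).
Local Notation tree_rel := (@tree_rel _ V).
Local Notation below := (below e L).

Definition unvisited q : {set V} := ~: L :\: [set x in q].

(** In increasing order, because the rule for closing walks compares vertices and
    the telescoping has to switch the neighbours in the same order. *)
Definition steps (p : seq V) : seq V :=
  [seq v <- sort <=%O (enum V) | [&& is_walk e (rcons p v), v \notin p & v \notin L]].

Lemma mem_steps p v :
  (v \in steps p) = [&& is_walk e (rcons p v), v \notin p & v \notin L].
Proof. by rewrite mem_filter mem_sort mem_enum andbT. Qed.

Lemma steps_sorted p : pairwise <%O (steps p).
Proof.
rewrite -sorted_pairwise; last exact: lt_trans.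
by apply: sorted_filter; [exact: lt_trans | rewrite sort_lt_sorted enum_uniq].
Qed.

Lemma unvisited_rcons q w : unvisited (rcons q w) = unvisited q :\ w.
Proof. by apply/setP => x; rewrite !inE mem_rcons inE negb_or andbA. Qed.

Lemma steps_walk (z : walk) q w : z \in SAW_avoiding -> z = rcons q w :> seq V ->
  forall v, (v \in steps z) = (v \in unvisited q :\ w) && e w v.
Proof.
move=> /SAW_avoidingP[wz uz _] zE v; rewrite mem_steps -unvisited_rcons zE.
rewrite is_walk_rcons2 -zE wz !inE /=.
by case: (e w v); rewrite ?andbF ?andbT.
Qed.

Lemma walk_end_unvisited (z : walk) q w : z \in SAW_avoiding -> z = rcons q w :> seq V ->
  w \in unvisited q.
Proof.
move=> /SAW_avoidingP[_ uz /allP Lz] zE; rewrite !inE Lz ?andbT ?zE ?mem_rcons ?inE ?eqxx //.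
by move: uz; rewrite zE rcons_uniq => /andP[].
Qed.

Lemma grow_SAW_avoiding (z : walk) v : z \in SAW_avoiding -> v \in steps z ->
  grow z v \in SAW_avoiding.
Proof.
move=> zS; rewrite mem_steps => /and3P[wv vz vL].
have /SAW_avoidingP[_ uz Lz] := zS.
apply/SAW_avoidingP; rewrite (growE _ zS); split=> //; first by rewrite rcons_uniq vz.
by rewrite all_rcons vL.
Qed.

Lemma lt_asym_neg x y : (x < y)%O -> ~~ (y < x)%O.
Proof. by move=> /ltW; rewrite leNgt. Qed.

Lemma spin_ratio_walk (z : walk) q w : z \in SAW_avoiding -> z = rcons q w :> seq V ->
  spin_ratio e beta gamma (unvisited q) (walk_field z) w
  = walk_field z w true / walk_field z w false
    * \prod_(v <- steps z) ratio_step beta gamma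
         (spin_ratio e beta gamma (unvisited z) (walk_field (rcons z v)) v).
Proof.
move=> zS zE; have wU := walk_end_unvisited zS zE.
rewrite (spin_ratio_rec e_sym e_irr gamma_gt0 beta_ge0 lt_asym_neg wU _ (steps_sorted z)
          (steps_walk zS zE)); last exact: admissible_walk.
congr (_ * _); apply: eq_big_seq => v vz; congr ratio_step.
rewrite zE unvisited_rcons; apply: spin_ratio_eq.
  by move: vz; rewrite (steps_walk zS zE) => /andP[].
move=> x _ c; rewrite walk_field_rcons //; rewrite -zE.
  by case/SAW_avoidingP: zS.
by move: vz; rewrite mem_steps => /and3P[].
Qed.

(** In the tree, the children of z other than v lie in other components than v,
    so their weights are irrelevant to the marginal at v. *)
Lemma spin_ratio_tree (z : walk) : z \in SAW_avoiding ->
  spin_ratio tree_rel beta gamma (below z) tree_field z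
  = tree_field z true / tree_field z false
    * \prod_(v <- steps z) ratio_step beta gamma
         (spin_ratio tree_rel beta gamma (below (grow z v)) tree_field (grow z v)).
Proof.
move=> zS; have [q [w zE]] := SAW_avoiding_nil zS.
have zz : z \in below z by rewrite inE zS prefix_refl.
pose r (p p' : walk) := (last w p < last w p')%O.
have r_asym p p' : r p p' -> ~~ r p' p by apply: lt_asym_neg.
have growP v : v \in steps z -> grow z v \in below z :\ z.
  move=> vz; rewrite 2!inE [grow z v \in below z]inE grow_SAW_avoiding //=.
  rewrite (growE _ zS) prefix_rconsr prefix_refl andbT.
  apply/eqP => /(congr1 (size \o val)) /=; rewrite (growE _ zS) size_rcons => /eqP.
  by rewrite gtn_eqF.
have pl : pairwise r (map (grow z) (steps z)).
  rewrite pairwise_map; apply: sub_pairwise (steps_sorted z) => x y xy.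
  by rewrite /r /= !(growE _ zS) !last_rcons.
have childE p : (p \in map (grow z) (steps z)) = (p \in below z :\ z) && tree_rel z p.
  apply/mapP/andP => [[v vz ->]|[]].
    split; first exact: growP.
    by apply/orP; left; apply/extendsP; exists v; rewrite (growE _ zS).
  rewrite 2!inE [p \in below z]inE => /and3P[_ pS zp] /orP[/extendsP[v pE]|/size_extends].
    exists v; last by apply: val_inj; rewrite /= (growE _ zS).
    have /SAW_avoidingP[wp] := pS; rewrite pE rcons_uniq all_rcons => /andP[vz _] /andP[vL _].
    by rewrite mem_steps -pE wp vz vL.
  by have := size_prefix zp => /= sp sz; move: sp; rewrite sz ltnn.
have aT := @admissible_tree R _ V e beta gamma lambda gamma_gt0 beta_ge0 lambda_gt0 L tau.
rewrite (spin_ratio_rec (@tree_rel_sym _ V) (@tree_rel_irr _ V) gamma_gt0 beta_ge0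
          r_asym zz (aT _) pl childE).
rewrite big_map; congr (_ * _); apply: eq_big_seq => v vz; congr ratio_step.
have gE := growE v zS; have gS := grow_SAW_avoiding zS vz.
have gg : grow z v \in below (grow z v) by rewrite inE gS prefix_refl.
rewrite (@spin_ratio_component _ _ _ (@tree_rel_sym _ V) (@tree_rel_irr _ V) beta gamma
           gamma_gt0 beta_ge0 _ (below (grow z v)) _ _ _ _ gg).
- apply: spin_ratio_eq => // p; rewrite inE => /andP[_ gp] c.
  have pE : tree_rel z p -> p = grow z v.
    case/orP => [/extendsP[x pE]|/size_extends sz]; last first.
      by have := size_prefix gp; rewrite gE size_rcons sz => /ltnW; rewrite ltnn.
    apply: val_inj; rewrite /= pE gE; move: gp; rewrite pE gE prefix_rconsr.
    case/orP => [/size_prefix|/eqP->] //.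
    by rewrite size_rcons ltnn.
  rewrite /hybrid /boost /=; case: (boolP (tree_rel z p)) => [/pE->|_]; last by rewrite !mulr1.
  by rewrite /r ltxx /= !mulr1.
- exact/admissible_hybrid/aT.
- apply/subsetP => p; rewrite inE => /andP[pS gp]; rewrite 2!inE [p \in below z]inE pS /=.
  rewrite (prefix_trans _ gp) ?gE ?prefix_rconsr ?prefix_refl // andbT.
  by apply: contraTneq gp => ->; apply/negP => /size_prefix; rewrite gE size_rcons ltnn.
move=> x y; rewrite inE => /andP[xS gx]; rewrite inE [y \in _ :\ z]inE inE.
case/and3P => ygy yz; rewrite inE => /andP[yS zy].
have {}ygy : ~~ prefix (grow z v) y by move: ygy; rewrite inE yS.
apply/negP => /orP[/extendsP[a yE]|/extendsP[a xE]].
  by move: ygy; rewrite yE prefix_rconsr gx.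
move: gx; rewrite xE prefix_rconsr (negPf ygy) gE => /eqP/rcons_inj[/val_inj zy' _].
by rewrite zy' eqxx in yz.
Qed.

(** Weitz's theorem: the ratios on the tree are ratios on the graph, because both
    satisfy the same recursion. *)
Lemma tree_ratio_walk (z : walk) q w : z \in SAW_avoiding -> z = rcons q w :> seq V ->
  spin_ratio tree_rel beta gamma (below z) tree_field z
  = spin_ratio e beta gamma (unvisited q) (walk_field z) w.
Proof.
have [n] := ubnP (#|V| - size z)%N; elim: n z q w => // n IHn z q w lez zS zE.
have tE c : tree_field z c = walk_field z w c.
  have /SAW_avoidingP[wz uz Lz] := zS.
  by rewrite zE tree_field_walk // -zE.
rewrite spin_ratio_tree // (spin_ratio_walk zS zE) !tE; congr (_ * _).
apply: eq_big_seq => v vz; congr ratio_step.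
have gE := growE v zS; have gS := grow_SAW_avoiding zS vz.
rewrite (IHn _ z v) // ?gE //.
have := SAW_avoiding_size gS; rewrite gE size_rcons; move: lez; lia.
Qed.

Lemma plus_influence_walk (z : walk) q w u : z \in SAW_avoiding -> z = rcons q w :> seq V ->
    u != w ->
  plus_influence e beta gamma (unvisited q) (walk_field z) w u
  = \sum_(v <- steps z)
       influence_step beta gamma
         (spin_ratio e beta gamma (unvisited z) (walk_field (rcons z v)) v)
       * plus_influence e beta gamma (unvisited z) (walk_field (rcons z v)) v u.
Proof.
move=> zS zE uw; have wU := walk_end_unvisited zS zE.
rewrite (plus_influence_rec e_sym e_irr gamma_gt0 beta_ge0 lt_asym_neg wU _ (steps_sorted z)
          (steps_walk zS zE) uw); last exact: admissible_walk.
apply: eq_big_seq => v vz; rewrite zE unvisited_rcons.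
have fE x : x \in unvisited q :\ w ->
    hybrid beta gamma <%O (e w) v (walk_field (rcons q w)) x =1 walk_field (rcons (rcons q w) v) x.
  move=> _ c; rewrite walk_field_rcons //; rewrite -zE.
    by case/SAW_avoidingP: zS.
  by move: vz; rewrite mem_steps => /and3P[].
rewrite (spin_ratio_eq _ _ _ _ fE); last by move: vz; rewrite (steps_walk zS zE) => /andP[].
by rewrite (plus_influence_eq _ _ _ _ _ fE).
Qed.

(** The ratio in an influence weight is taken on the tree; [tree_ratio_walk] turns
    it into the ratio met in the expansion of the influence. *)
Lemma phi_step (z : walk) v : z \in SAW_avoiding -> v \in steps z ->
  let r := spin_ratio e beta gamma (unvisited z) (walk_field (rcons z v)) v in
  0 < r -> phi e beta gamma lambda L tau (z, grow z v) = influence_step beta gamma r.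
Proof.
move=> zS vz /= r_gt0; have gE := growE v zS; have gS := grow_SAW_avoiding zS vz.
rewrite /phi /= !(SAW_avoiding_boundary _ zS, SAW_avoiding_boundary _ gS) /=.
rewrite ratio_below // (tree_ratio_walk gS gE) gE /= leNgt r_gt0 /=.
by rewrite /h_fin lnK ?posrE.
Qed.

Variable zeta : R.
Hypothesis zeta_ge : phi_norm e beta gamma lambda L tau <= zeta.

Lemma phi_norm_ge0 : 0 <= phi_norm e beta gamma lambda L tau.
Proof. by rewrite /phi_norm; elim/big_rec: _ => // d x _ x0; rewrite le_max x0 orbT. Qed.

(** A factor with ratio 0 vanishes; the others are influence weights. *)
Lemma influence_step_le (z : walk) v : z \in SAW_avoiding -> v \in steps z ->
  `|influence_step beta gamma
      (spin_ratio e beta gamma (unvisited z) (walk_field (rcons z v)) v)| <= zeta.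
Proof.
move=> zS vz; have gE := growE v zS; have gS := grow_SAW_avoiding zS vz.
set r := spin_ratio _ _ _ _ _ _.
have [r_gt0|r_le0] := ltP 0 r.
  rewrite -(phi_step zS vz) //; apply: le_trans zeta_ge.
  rewrite /phi_norm (bigD1 (z, grow z v)) ?le_max ?lexx //=.
  have [q [w zE]] := SAW_avoiding_nil zS.
  case E : (z : seq V) => [|x s]; first by rewrite E in zE; case: (q) zE.
  apply/bigcupP; exists x.
    by rewrite inE; apply/existsP; exists z; rewrite zS E /= eqxx.
  rewrite inE /= [z \in walk_tree _ _]inE [grow z v \in walk_tree _ _]inE zS gS gE E /= eqxx.
  by apply/extendsP; exists v.
have -> : r = 0.
  apply/le_anti; rewrite r_le0 spin_ratio_ge0 //; last exact: admissible_walk.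
  by have := walk_end_unvisited gS gE.
rewrite /influence_step mulr0 mul0r oppr0 normr0.
exact: le_trans phi_norm_ge0 zeta_ge.
Qed.

Lemma ends_at_rcons q w u : ends_at (rcons q w) u = (w == u).
Proof. by case: q => [|x q] //=; rewrite last_rcons. Qed.

(** Iterating [plus_influence_rec] along a walk, each step contributes a factor of
    modulus at most zeta. *)
Lemma plus_influence_le (z : walk) q w u : z \in SAW_avoiding -> z = rcons q w :> seq V ->
  `|plus_influence e beta gamma (unvisited q) (walk_field z) w u|
  <= \sum_(p in below z | ends_at p u) zeta ^+ (size p - size z).
Proof.
have zeta0 : 0 <= zeta := le_trans phi_norm_ge0 zeta_ge.
have [n] := ubnP (#|V| - size z)%N; elim: n z q w => // n IHn z q w lez zS zE.
have [uw|uw] := eqVneq u w.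
  rewrite /plus_influence uw eqxx normr1 (bigD1 z) /=; last first.
    by rewrite inE zS prefix_refl zE ends_at_rcons eqxx.
  by rewrite subnn expr0 lerDl sumr_ge0 // => p _; rewrite exprn_ge0.
rewrite (plus_influence_walk zS zE uw).
apply: le_trans (ler_norm_sum _ _ _) _.
have ust : uniq (steps z) by rewrite filter_uniq // sort_uniq enum_uniq.
rewrite big_uniq //= (partition_big (fun p : walk => nth w p (size z)) predT) //=.
rewrite big_mkcond /=; apply: ler_sum => v _; case: ifP => [vz|_]; last first.
  by apply: sumr_ge0 => p _; rewrite exprn_ge0.
have gE := growE v zS; have gS := grow_SAW_avoiding zS vz.
have gl : (#|V| - size (grow z v) < n)%N.
  by have := SAW_avoiding_size gS; rewrite gE size_rcons; move: lez; lia.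
have := IHn _ z v gl gS gE; rewrite {1}gE normrM.
set I := plus_influence _ _ _ _ _ _ _ => leI.
apply: le_trans (ler_pM _ _ (influence_step_le zS vz) leI) _; rewrite ?normr_ge0 //.
rewrite mulr_sumr [X in X <= _]big_mkcond [X in _ <= X]big_mkcond /=.
apply: ler_sum => p _; rewrite inE [p \in below z]inE.
case: (boolP (p \in SAW_avoiding)) => //= pS.
case: (boolP (ends_at p u)); rewrite ?andbF //= !andbT => _.
have [gp|_] := boolP (prefix (grow z v) p); last by case: ifP; rewrite // exprn_ge0.
case/prefixP: gp => s pE; rewrite pE gE cat_rcons prefix_prefix.
by rewrite nth_cat ltnn subnn /= eqxx size_cat size_rcons addKn /= addnS subSS addKn exprS.
Qed.

End WalkExpansion.

(** * Self-avoiding walks as paths of the non-backtracking walk-trees *)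

Section Trace.
Variables (R : realType) (V : finType) (e : rel V).
Implicit Types (r u v : V).

Local Notation walk := (#|V|.+1.-bseq V).
Local Notation NB := (NB e #|V|).

Lemma uniq_nonbacktracking (p : seq V) : uniq p -> nonbacktracking p.
Proof.
elim: p => // x p IHp /= /andP[xp up]; rewrite IHp // andbT.
by case: p xp {IHp up} => [|y [|z p]] //; rewrite !inE !negb_or => /and3P[].
Qed.

Definition trace (p : walk) : seq walk :=
  [seq insubd p (take i.+1 p) | i <- iota 0 (size p)].

Lemma size_trace p : size (trace p) = size p.
Proof. by rewrite size_map size_iota. Qed.

Lemma nth_trace d (p : walk) i : (i < size p)%N ->
  nth d (trace p) i = take i.+1 p :> seq V.
Proof.
move=> ip; rewrite (nth_map 0%N) ?size_iota // nth_iota // add0n val_insubd.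
by rewrite (leq_trans _ (size_bseq p)) // size_take; case: ifP => // /ltnW.
Qed.

Lemma trace_size p : (size (trace p) <= #|V|.+1)%N.
Proof. by rewrite size_trace size_bseq. Qed.

Definition trace_bseq (p : walk) : #|V|.+1.-bseq walk := Bseq (trace_size p).

Lemma trace_bseq_inj : {in [pred p : walk | p != [::] :> seq V] &, injective trace_bseq}.
Proof.
move=> p q; rewrite !inE -!size_eq0 => p0 q0 /(congr1 val) /= pq.
have sE : size p = size q by rewrite -(size_trace p) pq size_trace.
have nE : nth p (trace p) (size p).-1 = nth p (trace q) (size p).-1 by rewrite pq.
apply: val_inj; rewrite /= -(take_size p) -(take_size q).
have {1}-> : size p = (size p).-1.+1 by case: (size p) p0.
have -> : size q = (size p).-1.+1 by rewrite -sE; case: (size p) p0.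
rewrite -(nth_trace p) ?nE ?nth_trace //; first by rewrite -sE; case: (size p) p0.
by case: (size p) p0.
Qed.

(** The vertices on the path of the walk-tree that ends at p are the prefixes of p. *)
Lemma trace_path_to_copy r u (p : walk) :
    is_walk e p -> uniq p -> prefix [:: r] p -> ends_at p u ->
  path_to_copy NB r u (trace p).
Proof.
move=> wp up /prefixP[s' pE] pu.
have sp : size p = (size s').+1 by rewrite pE.
have treeP i : (i < size p)%N -> nth p (trace p) i \in walk_tree NB r.
  move=> ip; rewrite inE [_ \in NB]inE !nth_trace // uniq_nonbacktracking ?take_uniq //.
  move: wp; rewrite -{1}(cat_take_drop i.+1 p) pE /= eqxx !andbT.
  by rewrite cat_path => /andP[].
case E : (trace p) => [|p0 M'].
  by have := size_trace p; rewrite E sp.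
have n0 : nth p (trace p) 0 = p0 by rewrite E.
have t0 : p0 = [:: r] :> seq V by rewrite -n0 nth_trace ?sp // pE /= take0.
have sM : size p = (size M').+1 by rewrite -(size_trace p) E.
rewrite /path_to_copy t0 eqxx -n0 treeP ?sp //=; apply/andP; split.
  have : sorted (fun p1 p2 => (p1, p2) \in tree_edges NB r) (trace p).
    apply/(sortedP p) => i; rewrite size_trace => ip.
    rewrite inE /= !treeP // 1?ltnW //=; apply/extendsP.
    exists (nth r p i.+1); rewrite !nth_trace // 1?ltnW //.
    by rewrite -take_nth.
  by rewrite E.
have -> : last (nth p (trace p) 0) M' = nth p (trace p) (size M').
  by rewrite n0 E; exact: (esym (nth_last p (p0 :: M'))).
by rewrite nth_trace ?sM // -sM take_size.
Qed.

Lemma prod_trace (zeta : R) p : \prod_(d <- path_edges (trace p)) zeta = zeta ^+ (size p - 1).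
Proof.
rewrite big_const_seq count_predT size_zip size_behead size_trace subn1.
by rewrite iter_mulr_1 (minn_idPr (leq_pred _)).
Qed.

Definition walk_entry (zeta : R) r u : R :=
  \sum_(M : #|V|.+1.-bseq walk | path_to_copy NB r u M) \prod_(d <- path_edges M) zeta.

(** A self-avoiding walk is non-backtracking, and distinct walks are reached by
    distinct paths from the root, so the sum is part of the entry of the
    walk-matrix. *)
Lemma sum_walks_le (zeta : R) r u (A : {set walk}) : 0 <= zeta ->
    (forall p, p \in A -> [/\ is_walk e p, uniq p & prefix [:: r] p]) ->
  \sum_(p in A | ends_at p u) zeta ^+ (size p - 1) <= walk_entry zeta r u.
Proof.
move=> zeta0 AP.
have -> : \sum_(p in A | ends_at p u) zeta ^+ (size p - 1)
  = \sum_(M in trace_bseq @: [set p in A | ends_at p u]) \prod_(d <- path_edges M) zeta.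
  rewrite big_imset /= => [|p q].
    by apply: eq_big => [p|p _]; rewrite ?inE ?prod_trace.
  rewrite !inE => /andP[/AP[wp _ _] _] /andP[/AP[wq _ _] _].
  by apply: trace_bseq_inj; rewrite inE; [case: (p : seq V) wp | case: (q : seq V) wq].
rewrite /walk_entry [X in _ <= X](bigID (mem (trace_bseq @: [set p in A | ends_at p u]))) /=.
rewrite [X in _ <= X + _](eq_bigl (mem (trace_bseq @: [set p in A | ends_at p u]))).
  by rewrite lerDl sumr_ge0 // => M _; rewrite prodr_ge0.
move=> M /=; apply: andb_idl => /imsetP[p]; rewrite inE => /andP[/AP[wp up rp] pu] ->.
exact: trace_path_to_copy.
Qed.

Lemma walk_entry_ge0 (zeta : R) r u : 0 <= zeta -> 0 <= walk_entry zeta r u.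
Proof. by move=> zeta0; apply: sumr_ge0 => M _; rewrite prodr_ge0. Qed.

Lemma walk_vertices_NB : walk_vertices NB = setT.
Proof.
apply/setP => r; rewrite !inE; apply/existsP.
have s1 : (size [:: r] <= #|V|.+1)%N by [].
by exists (Bseq s1); rewrite inE /= eqxx.
Qed.

End Trace.

(** * Monotonicity of the spectral radius *)

Section Perron.
Variables (R : realType) (n : nat) (B : 'M[R]_n).
Hypothesis B_ge0 : forall i j, 0 <= B i j.
Implicit Types (s t : R) (x y z : 'rV[R]_n).

(** A positive vector x that certifies that all eigenvalues of B have modulus
    smaller than s. *)
Definition contracted s : Prop :=
  exists2 x : 'rV[R]_n, forall j, 0 < x 0 j & forall j, (x *m B) 0 j < s * x 0 j.

Lemma contracted_le s t : s <= t -> contracted s -> contracted t.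
Proof.
move=> st [x x0 xB]; exists x => // j; apply: lt_le_trans (xB j) _.
by rewrite ler_wpM2r // ltW.
Qed.

(** Otherwise let i minimise z_i / x_i = m < 0: then z is at least m x, with equality
    at i, and the inequality for z contradicts the one for x there. *)
Lemma contracted_nonneg s z : contracted s ->
  (forall j, (z *m B) 0 j <= s * z 0 j) -> forall j, 0 <= z 0 j.
Proof.
move=> [x x0 xB] zB j; rewrite leNgt; apply/negP => zj.
case: (@arg_minP _ R 'I_n j predT (fun k => z 0 k / x 0 k) isT) => i _ imin.
set m := z 0 i / x 0 i in imin.
have m0 : m < 0.
  by apply: le_lt_trans (imin j isT) _; rewrite pmulr_llt0 ?invr_gt0.
have zm k : m * x 0 k <= z 0 k by rewrite -ler_pdivlMr ?imin.
have zi : z 0 i = m * x 0 i by rewrite /m divfK // gt_eqF.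
have : m * (x *m B) 0 i <= (z *m B) 0 i.
  rewrite !mxE mulr_sumr; apply: ler_sum => k _.
  by rewrite mulrA ler_wpM2r.
move=> /le_trans/(_ (zB i)); rewrite zi mulrCA leNgt ltr_nM2l // xB //.
Qed.

Lemma contracted_open s : contracted s -> exists2 d, 0 < d & contracted (s - d).
Proof.
move=> [x x0 xB]; pose f j := s - (x *m B) 0 j / x 0 j.
have f0 j : 0 < f j by rewrite subr_gt0 ltr_pdivrMr.
have S0 : 0 < 1 + \sum_j (f j)^-1.
  by rewrite ltr_pwDl // sumr_ge0 // => j _; rewrite invr_ge0 ltW.
(* This number is positive and smaller than each f j. *)
exists (1 + \sum_j (f j)^-1)^-1; first by rewrite invr_gt0.
exists x => // j; rewrite -ltr_pdivrMr // ltrBrDl -ltrBrDr -/(f j).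
rewrite invf_plt ?posrE // (bigD1 j) //= addrCA ltrDl ltr_pwDl //.
by rewrite sumr_ge0 // => k _; rewrite invr_ge0 ltW.
Qed.

Lemma contracted_large : exists s, contracted s.
Proof.
exists (1 + \sum_i \sum_j B i j); exists (const_mx 1) => j; rewrite !mxE // mulr1.
rewrite ltr_pwDl //; apply: ler_sum => i _; rewrite mxE mul1r (bigD1 j) //=.
by rewrite lerDl sumr_ge0.
Qed.

Lemma poly_ge0_right (p : {poly R}) (s : R) :
  (forall t, s < t -> 0 <= p.[t]) -> 0 <= p.[s].
Proof.
move=> p0; rewrite leNgt; apply/negP => ps.
have ps' : 0 < - p.[s] by rewrite oppr_gt0.
have [d d0 dP] := poly_cont s p ps'.
have d2 : 0 < d / 2 by rewrite divr_gt0.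
have sd : `|s + d / 2 - s| < d by rewrite addrAC subrr add0r gtr0_norm // ltr_pdivrMr // ltr_pMr // ltr1n.
have := dP _ sd; have : 0 <= p.[s + d / 2] by apply: p0; rewrite ltrDl.
by move=> pd /ltr_normlW; lra.
Qed.

(** A polynomial multiple of the row 1 * (X - B)^-1, where 1 has all entries 1. *)
Definition resolvent_row : 'rV[{poly R}]_n := const_mx 1 *m \adj (char_poly_mx B).

Lemma resolvent_rowE s j :
  (char_poly B).[s] = s * (resolvent_row 0 j).[s] - \sum_i (resolvent_row 0 i).[s] * B i j.
Proof.
have : resolvent_row *m char_poly_mx B = char_poly B *: const_mx 1.
  by rewrite /resolvent_row -mulmxA mul_adj_mx mul_mx_scalar.
move/matrixP/(_ 0 j); rewrite [RHS]mxE [const_mx _ _ _]mxE mulr1 => <-.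
have cE i k : char_poly_mx B i k = 'X *+ (i == k) - (B i k)%:P by rewrite !mxE.
rewrite [X in X.[_]]mxE horner_sum /= (bigD1 j) //= [in RHS](bigD1 j) //= opprD addrA.
congr (_ + _); first by rewrite hornerM cE eqxx mulr1n !hornerE; ring.
rewrite -sumrN; apply: eq_bigr => i ij.
by rewrite hornerM cE (negPf ij) mulr0n sub0r hornerN hornerC mulrN.
Qed.

(** Let t be the infimum of the numbers at least s for which B is contracted. If t
    were not a root of the characteristic polynomial c, the row
    c(t) * 1 * adj(t - B) would show that B is contracted at t: it is nonnegative,
    as the limit of the same rows at numbers larger than t, and its image by t - B
    is c(t)^2 * 1. But contraction is an open condition, which fails at s because
    of y. *)
Lemma perron s y : 0 <= s -> (forall j, 0 <= y 0 j) -> y != 0 ->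
  (forall j, s * y 0 j <= (y *m B) 0 j) -> exists2 t, s <= t & eigenvalue B t.
Proof.
move=> s0 y0 yN0 yB.
have sN : ~ contracted s.
  move=> cs; have yle : forall j, 0 <= (- y) 0 j.
    apply: contracted_nonneg cs _ => j.
    by rewrite mulNmx !mxE mulrN lerN2; have := yB j; rewrite mxE.
  case/eqP: yN0; apply/rowP => j; rewrite mxE; apply/le_anti; rewrite y0 andbT.
  by have := yle j; rewrite mxE oppr_ge0.
pose G : classical_sets.set R := fun t => s <= t /\ contracted t.
have Glb : classical_sets.lbound G s by move=> t [].
have G0 : classical_sets.nonempty G.
  have [t ct] := contracted_large; exists (Num.max s t); split; first by rewrite le_max lexx.
  by apply: contracted_le ct; rewrite le_max lexx orbT.
pose t := inf G.
have st : s <= t by apply: lb_le_inf.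
have gt_contracted t' : t < t' -> contracted t'.
  by move=> /(inf_lt G0)[g [_ cg] /ltW gt']; apply: contracted_le cg.
have tN : ~ contracted t.
  move=> /contracted_open[d d0 cd]; have [sd|ds] := leP s (t - d).
    have /(_ (t - d)) := @ge_inf R G (ex_intro _ s Glb); rewrite -/t => /(_ (conj sd cd)).
    by rewrite lerBrDr gerDl leNgt d0.
  by apply: sN; apply: contracted_le (ltW ds) cd.
exists t => //; rewrite eigenvalue_root_char; apply: contra_notT tN => tN.
pose c := char_poly B; pose x : 'rV[R]_n := \row_j (c * resolvent_row 0 j).[t].
have row_eq t' j : t' * (c * resolvent_row 0 j).[t']
      - \sum_i (c * resolvent_row 0 i).[t'] * B i j = c.[t'] ^+ 2.
  under eq_bigr do rewrite hornerM -mulrA.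
  rewrite -mulr_sumr hornerM mulrCA -mulrBr -resolvent_rowE expr2 //.
have x0 j : 0 <= x 0 j.
  rewrite mxE; apply: poly_ge0_right => t' tt'.
  pose x' : 'rV[R]_n := \row_j (c * resolvent_row 0 j).[t'].
  suff : 0 <= x' 0 j by rewrite mxE.
  apply: (contracted_nonneg (gt_contracted _ tt')) => k.
  rewrite -subr_ge0 [x' 0 k]mxE [(x' *m B) 0 k]mxE; under eq_bigr => i _ do rewrite [x' 0 i]mxE.
  by rewrite row_eq sqr_ge0.
have xB j : (x *m B) 0 j < t * x 0 j.
  rewrite -subr_gt0 [x 0 j]mxE [(x *m B) 0 j]mxE; under eq_bigr => i _ do rewrite [x 0 i]mxE.
  by rewrite row_eq exprn_even_gt0.
exists x => // j; rewrite lt_def x0 andbT; apply/eqP => xj.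
have := xB j; rewrite xj mulr0 ltNge => /negP; apply.
by rewrite mxE sumr_ge0 // => i _; rewrite mulr_ge0.
Qed.

End Perron.

Section SpectralRadius.
Variable R : realType.

Local Notation normc := (@Normc.normc R).

Lemma normc_real (x : R) : normc (real_complex R x) = `|x|.
Proof. by rewrite /= expr0n addr0 sqrtr_sqr. Qed.

Lemma normc_ge0 (x : R[i]) : 0 <= normc x.
Proof. by case: x => a b; rewrite sqrtr_ge0. Qed.

Lemma normc_sum (I : finType) (P : pred I) (F : I -> R[i]) :
  normc (\sum_(i | P i) F i) <= \sum_(i | P i) normc (F i).
Proof.
elim/big_rec2: _ => [|i y x _ xy]; first by rewrite Normc.normc0.
by apply: le_trans (le_normcD _ _) _; rewrite lerD2l.
Qed.

Lemma normc_eigen n (A : 'M[R]_n) z (v : 'rV[R[i]]_n) j :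
  v *m map_mx (real_complex R) A = z *: v ->
  normc z * normc (v 0 j) <= \sum_i normc (v 0 i) * `|A i j|.
Proof.
move=> /matrixP/(_ 0 j); rewrite !mxE => zv; rewrite -Normc.normcM -zv.
apply: le_trans (normc_sum _ _) _; apply: ler_sum => i _.
by rewrite Normc.normcM mxE normc_real.
Qed.

Lemma row_neq0P (K : nmodType) n (v : 'rV[K]_n) : v != 0 -> exists i, v 0 i != 0.
Proof.
move=> v0; apply/existsP; apply: contraNT v0 => /existsPn v0.
by apply/eqP/rowP => i; rewrite mxE; apply/eqP/negPn.
Qed.

Lemma eigenvalue_le n (A : 'M[R]_n) z : eigenvalue (map_mx (real_complex R) A) z ->
  normc z <= \sum_j \sum_i `|A i j|.
Proof.
case/eigenvalueP => v vA /row_neq0P[i0 v0].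
have S0 : 0 < \sum_i normc (v 0 i).
  rewrite (bigD1 i0) //= ltr_pwDl ?sumr_ge0 // => [|i _]; last exact: normc_ge0.
  by rewrite lt_def normc_ge0 andbT; apply: contra v0 => /eqP/Normc.eq0_normc->.
rewrite -(ler_pM2r S0) mulr_sumr [leRHS]mulr_suml.
apply: ler_sum => j _; apply: le_trans (normc_eigen _ vA) _.
rewrite mulr_suml; apply: ler_sum => i _; rewrite mulrC ler_wpM2l //.
by rewrite (bigD1 i) //= lerDl sumr_ge0 // => k _; apply: normc_ge0.
Qed.

Lemma eigenvalue_le_spectral_radius n (A : 'M[R]_n) z :
  eigenvalue (map_mx (real_complex R) A) z -> normc z <= spectral_radius A.
Proof.
move=> Az; apply: ub_le_sup; last by exists z.
by exists (\sum_j \sum_i `|A i j|) => _ [w Aw ->]; apply: eigenvalue_le.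
Qed.

Lemma spectral_radius_ge0 n (A : 'M[R]_n) : 0 <= spectral_radius A.
Proof.
have [[z Az]|nA] := boolp.pselect (exists z, eigenvalue (map_mx (real_complex R) A) z).
  exact: le_trans (normc_ge0 z) (eigenvalue_le_spectral_radius Az).
rewrite /spectral_radius (_ : classical_sets.mkset _ = classical_sets.set0) ?sup0 //.
by apply/classical_sets.seteqP; split=> // t [z Az _]; case: nA; exists z.
Qed.

(** A matrix dominated by a nonnegative one, which may have more rows and
    columns: the moduli of an eigenvector of the former, extended by zero, are
    a subinvariant vector of the latter. *)
Lemma spectral_radius_le (T : finType) (D D' : {set T}) (a b : T -> T -> R) :
    D \subset D' -> (forall x y, 0 <= b x y) ->
    (forall x y, x \in D -> y \in D -> `|a x y| <= b x y) ->
  spectral_radius (mx_on D a) <= spectral_radius (mx_on D' b).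
Proof.
move=> /subsetP DD' b0 ab.
have [[z0 Az0]|nA] := boolp.pselect (exists z, eigenvalue (map_mx (real_complex R) (mx_on D a)) z);
  last first.
  rewrite {1}/spectral_radius (_ : classical_sets.mkset _ = classical_sets.set0).
    by rewrite sup0 spectral_radius_ge0.
  by apply/classical_sets.seteqP; split=> // t [z Az _]; case: nA; exists z.
apply: ge_sup => [|_ [z Az ->]]; first by exists (normc z0), z0.
case/eigenvalueP: Az => v vA /row_neq0P[i0 v0].
pose g x := \sum_(i : 'I_#|D| | enum_val i == x) normc (v 0 i).
have g0 x : 0 <= g x by apply: sumr_ge0 => i _; apply: normc_ge0.
have gE i : g (enum_val i) = normc (v 0 i).
  by rewrite /g (big_pred1 i) // => j; rewrite (inj_eq enum_val_inj).
have gN x : x \notin D -> g x = 0.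
  by move=> xD; rewrite /g big_pred0 // => i; apply: contraNF xD => /eqP<-; apply: enum_valP.
have sumE (E : {set T}) (f : T -> R) : \sum_(i < #|E|) f (enum_val i) = \sum_(x in E) f x.
  by rewrite [RHS]big_enum_val.
pose y : 'rV[R]_#|D'| := \row_k g (enum_val k).
have [|||j|t zt Bt] := @perron R #|D'| (mx_on D' b) _ (normc z) y (normc_ge0 z).
- by move=> i j; rewrite mxE.
- by move=> j; rewrite mxE.
- have i0D' := DD' _ (enum_valP i0).
  apply: contra v0 => /eqP/rowP/(_ (enum_rank_in i0D' (enum_val i0))).
  by rewrite !mxE enum_rankK_in // gE => /Normc.eq0_normc->.
- rewrite !mxE; under eq_bigr do rewrite !mxE.
  rewrite (sumE D' (fun x => g x * b x (enum_val j))).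
  have [jD|jD] := boolP (enum_val j \in D); last first.
    by rewrite gN // mulr0 sumr_ge0 // => x _; rewrite mulr_ge0.
  rewrite (big_setID D) /= -[X in X <= _]addr0 lerD ?sumr_ge0 //; last first.
    by move=> x _; rewrite mulr_ge0.
  rewrite (setIidPr _) //; last exact/subsetP.
  rewrite -(sumE D (fun x => g x * b x (enum_val j))).
  rewrite -(enum_rankK_in jD jD) gE; apply: le_trans (normc_eigen _ vA) _.
  apply: ler_sum => i _; rewrite gE mxE ler_wpM2l ?normc_ge0 //.
  by rewrite ab // enum_valP.
apply: le_trans zt _; apply: le_trans (ler_norm t) _; rewrite -normc_real.
apply: eigenvalue_le_spectral_radius.
move: Bt; rewrite !eigenvalue_root_char => Bt.
by rewrite -map_char_poly fmorph_root.
Qed.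

End SpectralRadius.

(** * The comparison of the two spectral radii *)

Theorem corollary7p3 (R : realType) (disp : Order.disp_t)
    (V : finOrderType disp) (e : rel V)
    (e_sym : symmetric e) (e_irr : irreflexive e)
    (e_conn : forall x y : V, connect e x y)
    (beta gamma lambda : R)
    (gamma_gt0 : 0 < gamma) (beta_ge0 : 0 <= beta) (beta_le_gamma : beta <= gamma)
    (lambda_gt0 : 0 < lambda)
    (L : {set V}) (tau : V -> bool) (zeta : R)
    (zeta_ge : phi_norm e beta gamma lambda L tau <= zeta) :
  spectral_radius (influence_mx e beta gamma lambda L tau)
    <= spectral_radius (walk_mx (NB e #|V|) (fun=> zeta)).
Proof.
have zeta0 : 0 <= zeta := le_trans (phi_norm_ge0 _ _ _ _ _ _) zeta_ge.
apply: (@spectral_radius_le R V (~: L) (walk_vertices (NB e #|V|))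
          (influence e beta gamma lambda L tau) (walk_entry e zeta)).
- by rewrite walk_vertices_NB subsetT.
- by move=> r u; apply: walk_entry_ge0.
move=> r u; rewrite !inE => rL uL.
have [->|->] := influenceE e_sym e_irr gamma_gt0 beta_ge0 lambda_gt0 tau rL uL.
  by rewrite normr0 walk_entry_ge0.
have size_r : (size [:: r] <= #|V|.+1)%N by [].
pose z : #|V|.+1.-bseq V := Bseq size_r.
have zS : z \in SAW_avoiding e L by rewrite inE /= rL.
have -> : plus_influence e beta gamma (~: L) (pinned_field e beta gamma lambda L tau) r u
        = plus_influence e beta gamma (unvisited L [::])
            (walk_field e beta gamma lambda L tau z) r u.
  have -> : unvisited L [::] = ~: L by apply/setP => x; rewrite !inE.
  by apply: plus_influence_eq => x _ c; rewrite walk_field1.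
apply: le_trans (plus_influence_le e_sym e_irr gamma_gt0 beta_ge0 lambda_gt0 zeta_ge u
                   zS (q := [::]) erefl) _.
apply: sum_walks_le => // p; rewrite inE => /andP[/SAW_avoidingP[wp up _] zp].
by split.
Qed.
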